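(* Let $X$ be a connected, locally connected, hereditarily unicoherent compact Hausdorff space. Let $F \in \mathcal{H}(C(X))$ be an entire function (in the sense of Lorch) which is nondegenerate at every point of $X$ and has no asymptotic roots. Assume that there exist $x_0 \in X$ and $z_0 \in \mathbb{C}$ such that $F(x_0,z_0)=0$. Then there exists $w \in C(X)$ such that $w(x_0)=z_0$ and $F(x,w(x))=0$ for all $x \in X$.
   Context: For a topological space $Y$, $C(Y)$ denotes the set of continuous functions $Y \to \mathbb{C}$; for $X$ compact Hausdorff, $C(X)$ is a Banach algebra with the supremum norm. Hereditarily unicoherent: $X$ is hereditarily unicoherent if $A \cap B$ is connected for all closed connected subsets $A,B \subset X$ (the empty set being regarded as connected). Entire functions: $F : C(X) \to C(X)$ is entire (in the sense of Lorch) if it is Fréchet differentiable at every $w \in C(X)$ and its differential at $w$ is a multiplication operator $h \mapsto F'(w)h$ for some $F'(w) \in C(X)$. Equivalently, $F(w) = \sum_{n=0}^{\infty} a_n w^n$ for all $w \in C(X)$, where $a_n \in C(X)$ and $\limsup_n \|a_n\|^{1/n} = 0$ (the series converging in norm for each $w$). The set of entire functions is denoted $\mathcal{H}(C(X))$. To $F$ one associates the map $X \times \mathbb{C} \to \mathbb{C}$, also denoted $F$, given by $F(x,z) = \sum_{n=0}^{\infty} a_n(x) z^n$; it is continuous on $X\times\mathbb{C}$, holomorphic in $z$ for fixed $x$, and determines $F$. Nondegeneracy: $F \in \mathcal{H}(C(X))$ is degenerate at $x_0 \in X$ if the map $z \mapsto F(x_0,z)$ is constant; otherwise it is nondegenerate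 at $x_0$. Asymptotic roots: Let $Y \subset X$ be a connected subset and $x_0 \in \overline{Y}\setminus Y$. A function $w \in C(Y)$ is an asymptotic root of $F$ if $F(x,w(x))=0$ for all $x \in Y$ and $\lim_{x \to x_0,\ x \in Y} w(x) = \infty$ (i.e. $|w(x)| \to \infty$). ''$F$ has no asymptotic roots'' means that no such triple $(Y,x_0,w)$ exists. *)

(* Defs.v *)
From mathcomp Require Import all_boot all_order all_algebra.
From mathcomp Require Import all_classical all_reals all_analysis.
From mathcomp Require Import complex.

Set Implicit Arguments.
Unset Strict Implicit.
Unset Printing Implicit Defensive.

Import Order.TTheory GRing.Theory Num.Theory numFieldNormedType.Exports.

Local Open Scope classical_set_scope.
Local Open Scope ring_scope.

Section TopologicalNotions.
Variable X : topologicalType.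

Definition locally_connected : Prop :=
  forall (x : X) (U : set X), nbhs x U ->
    exists V : set X, [/\ open V, connected V, V x & V `<=` U].

(* [connected set0] holds in the library, so an empty intersection is
   allowed. *)
Definition hereditarily_unicoherent : Prop :=
  forall A B : set X, closed A -> connected A -> closed B -> connected B ->
    connected (A `&` B).

End TopologicalNotions.

(* [R[i]] is the field of complex numbers; its topology is that of the normed
   module [R[i]^o] over itself. *)
Notation CC R := (R[i]^o).

Notation CX X R := (continuousType X (CC R)).

Section Lorch.
Variables (R : realType) (X : topologicalType).
Implicit Types F : CX X R -> CX X R.

Definition modulus (z : CC R) : R := complex.Re `|z|.

(* The supremum is that of a bounded set when [X] is compact and [f] is
   continuous, the only case in which it is used. *)
Definition supnorm (f : X -> CC R) : R := sup [set modulus (f x) | x in [set: X]].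

(* [g] is the multiplier of the Frechet differential of [F] at [w], written
   with [v = w + h]. *)
Definition lorch_derivative F (w g : CX X R) : Prop :=
  forall e : R, 0 < e -> exists2 d : R, 0 < d &
    forall v : CX X R, supnorm (v \- w) < d ->
      supnorm ((F v \- F w) \- (g \* (v \- w))) <= e * supnorm (v \- w).

Definition lorch_entire F : Prop :=
  forall w : CX X R, exists g : CX X R, lorch_derivative F w g.

(* The map X * C -> C associated with F: F(x, z) = \sum_n a_n(x) z^n is the
   value at x of F(w) = \sum_n a_n w^n for w the constant function z (see
   [assoc_mapE]). *)
Definition assoc_map F (x : X) (z : CC R) : CC R := F (cst z) x.

Definition power_expansion F (a : nat -> CX X R) : Prop :=
  supnorm (a n) `^ (n%:R^-1) @[n --> \oo] --> (0 : R) /\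
  forall w : CX X R,
    supnorm (fun x => F w x - \sum_(k < n) a k x * w x ^+ k) @[n --> \oo]
      --> (0 : R).

Lemma modulusE (z : CC R) : (modulus z)%:C%C = `|z|.
Proof. by rewrite /modulus RRe_real// normr_real. Qed.

Lemma le_supnorm (f : X -> CC R) (x : X) :
  compact [set: X] -> continuous f -> modulus (f x) <= supnorm f.
Proof.
move=> cX cf; apply: ub_le_sup; last by exists x.
have cm : continuous (modulus \o f).
  move=> y; apply/cvgrPdist_lt => e e0.
  have e0' : 0 < e%:C%C :> R[i] by rewrite ltcR.
  move/cvgrPdist_lt: (cf y) => /(_ _ e0'); apply: filterS => t /=.
  rewrite -ltcR; apply: le_lt_trans.
  have -> : `|modulus (f y) - modulus (f t)|%:C%C = `| `|f y| - `|f t| | :> R[i].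
    rewrite -!modulusE -rmorphB; apply/esym.
    by rewrite [LHS]normc_def /= expr0n /= addr0 sqrtr_sqr.
  exact: ler_dist_dist.
have := compact_bounded (continuous_compact (continuous_subspaceT cm) cX).
move=> [M [_ bM]]; exists (M + 1) => _ [y _ <-].
apply: le_trans (ler_norm _) _; apply: (bM (M + 1)); first by rewrite ltrDl.
by exists y.
Qed.

Lemma continuous_sum_mul (K : numFieldType) (f : nat -> X -> K^o)
    (c : nat -> K) (n : nat) :
  (forall k, continuous (f k)) ->
  continuous (fun x => \sum_(k < n) f k x * c k).
Proof.
move=> cf y; apply: cvg_big => [|k _]; first exact: add_continuous.
by apply: cvgMr_tmp; exact: cf.
Qed.

Lemma assoc_mapE F (a : nat -> CX X R) (x : X) (z : CC R) :
  compact [set: X] -> power_expansion F a ->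
  \sum_(k < n) a k x * z ^+ k @[n --> \oo] --> assoc_map F x z.
Proof.
move=> cX [_ /(_ (cst z)) Fz].
apply/cvgrPdist_lt => e e0.
have er : (complex.Re e)%:C%C = e by rewrite RRe_real// gtr0_real.
have e0' : 0 < complex.Re e by rewrite -ltcR er.
move/cvgrPdist_lt: Fz => /(_ _ e0'); apply: filterS => n.
rewrite sub0r normrN => /(le_lt_trans (ler_norm _)) ltn.
rewrite -er -modulusE ltcR; apply: le_lt_trans ltn.
apply: (@le_supnorm (fun x => F (cst z) x - \sum_(k < n) a k x * z ^+ k)) => //.
move=> y; apply: cvgB; first exact: cts_fun.
by apply: (@continuous_sum_mul R[i] (fun k => a k)) => k; exact: cts_fun.
Qed.

Definition degenerate F (x : X) : Prop :=
  exists c : CC R, forall z : CC R, assoc_map F x z = c.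

(* Only the restriction of [w] to [Y] is constrained, so [w] stands for an
   element of C(Y). *)
Definition asymptotic_root F (Y : set X) (x0 : X) (w : X -> CC R) : Prop :=
  [/\ connected Y,
      (closure Y `\` Y) x0,
      {within Y, continuous w},
      (forall x, Y x -> assoc_map F x (w x) = 0) &
      modulus (w x) @[x --> within Y (nbhs x0)] --> +oo].

Definition no_asymptotic_roots F : Prop :=
  ~ exists (Y : set X) (x0 : X) (w : X -> CC R), asymptotic_root F Y x0 w.

End Lorch.

(* Main.v *)
(* Write Z for the zero set of F in X * C. Zeros of an entire function persist
   under small perturbations and are isolated, so a continuous root over a
   connected set is trapped in small discs whose boundary circles avoid Z. In X
   the intersection of any two connected sets is connected; hence unions of
   chains of partial roots are again continuous, and a bounded partial root
   extends to the closure of its domain. By Zorn's lemma a maximal partial root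
   has a closed connected domain Y, and a component C of the complement of Y
   touches Y in a single point e, so it suffices to lift locally through
   (e, w(e)). This is done by induction on a local bound N for the number of
   distinct zeros in a disc: where there is a single zero there is no choice;
   elsewhere the zeros split into at least two clusters of at most N - 1 zeros
   each, and the induction hypothesis gives roots on the components of that open
   set, which glue because near a point with a single zero all zeros are close.

   The complex analysis needed (openness of zeros and the local bound on their
   number) follows from |g(a)| <= max_{|z - a| = r} |g|, proved by Goursat's
   subdivision argument in the coordinates z = a + exp(x + i t). *)
Require Import Defs.
From mathcomp Require Import all_boot all_order all_algebra.
From mathcomp Require Import all_classical all_reals all_analysis.
From mathcomp Require Import complex.
From mathcomp Require Import ring lra.

Set Implicit Arguments.
Unset Strict Implicit.
Unset Printing Implicit Defensive.

Import Order.TTheory GRing.Theory Num.Theory numFieldNormedType.Exports.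
Local Open Scope classical_set_scope.
Local Open Scope ring_scope.

(** * Connected sets in hereditarily unicoherent spaces *)

Section ConnectedSets.
Context {X : topologicalType}.
Implicit Types (A B C K U W Y : set X).

Lemma connected_between A B :
  connected A -> A `<=` B -> B `<=` closure A -> connected B.
Proof.
move=> cA AB BA; apply/connectedP => E [E0 EB sE].
have AE : A `<=` E false `|` E true by rewrite -EB.
have [sep1 sep2] := sE.
have [AF|AT] := connected_subset sE AE cA.
- have [x Ex] := E0 true; suff : set0 x by [].
  rewrite -sep1; split => //; apply: (closureS AF); apply: BA.
  by rewrite EB; right.
- have [x Ex] := E0 false; suff : set0 x by [].
  rewrite -sep2; split => //; apply: (closureS AT); apply: BA.
  by rewrite EB; left.
Qed.

Lemma connected_setU1 A x : connected A -> closure A x -> connected (A `|` [set x]).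
Proof.
move=> cA Ax; apply: connected_between cA _ _; first by move=> y; left.
by move=> y [Ay|->//]; apply: subset_closure.
Qed.

Lemma connected_pairwise A :
  (forall a b, A a -> A b -> exists C, [/\ connected C, C `<=` A, C a & C b]) ->
  connected A.
Proof.
move=> AC; have [[a Aa]|/forallNP A0] := pselect (exists a, A a); last first.
  rewrite (_ : A = set0); first exact: connected0.
  by apply/seteqP; split => x // /A0.
rewrite (_ : A = connected_component A a); first exact: component_connected.
apply/seteqP; split; last exact: connected_component_sub.
by move=> b Ab; have [C [cC CA Ca Cb]] := AC a b Aa Ab; exists C.
Qed.

Lemma connected_hausdorff_pair (a b : X) :
  hausdorff_space X -> connected [set a; b] -> a = b.
Proof.
move=> hX cab; apply: contrapT => ab.
have clo (x : X) : closure [set x] = [set x].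
  by apply/esym/closure_id/accessible_closed_set1/hausdorff_accessible.
have sep : separated [set a] [set b].
  rewrite /separated !clo; split; apply/seteqP; split => x //= [-> /ab]//.
have [H|H] := connected_subset sep (@subset_refl _ _) cab.
  by apply/ab/esym/(H b); right.
by apply/ab/(H a); left.
Qed.

(** Closedness of [A] is asked only at points of [W], which is the form delivered by local extension
    arguments. *)
Lemma connected_clopen_sub W A :
  connected W -> W `&` A !=set0 -> open A -> W `&` closure A `<=` A -> W `<=` A.
Proof.
move=> cW WA oA clA; suff <- : W `&` A = W by move=> x [].
apply: cW => //; first by exists A.
exists (closure A); first exact: closed_closure.
apply/seteqP; split => x [Wx Ax]; split => //; first exact: subset_closure.
exact: clA.
Qed.

Lemma bigcup_total_connected (F : set (set X)) :
  total_on F subset -> (forall A, F A -> connected A) ->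
  connected (\bigcup_(A in F) A).
Proof.
move=> tF cF; apply: connected_pairwise => a b [A FA Aa] [B FB Bb].
have [AB|BA] := tF _ _ FA FB.
  by exists B; split; [exact: cF|move=> x ?; exists B|exact: AB|].
by exists A; split; [exact: cF|move=> x ?; exists A| |exact: BA].
Qed.

(** * Continua and components in locally connected, hereditarily unicoherent compact spaces *)

Section LocallyConnected.
Hypothesis X_lc : locally_connected X.

Lemma open_component A x : open A -> open (connected_component A x).
Proof.
move=> oA; rewrite openE => y Axy.
have Ay := connected_component_sub Axy.
have [V [oV cV Vy VA]] := X_lc (open_nbhs_nbhs (conj oA Ay)).
apply: filterS (open_nbhs_nbhs (conj oV Vy)) => z Vz; apply: connected_component_trans Axy _.
by exists V.
Qed.

Hypothesis X_connected : connected [set: X].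
Hypothesis X_compact : compact [set: X].
Hypothesis X_hausdorff : hausdorff_space X.

Lemma nbhs_closed_connected x U : nbhs x U ->
  exists V, [/\ open V, connected V, V x & closure V `<=` U].
Proof.
move=> Ux; have [V xV VU] := compact_regular X_hausdorff X_compact filterT Ux.
have [V' [oV' cV' V'x V'V]] := X_lc xV.
by exists V'; split => //; apply: subset_trans VU; exact: closureS.
Qed.

(** The points joined to [a] by a continuum inside [U] form a clopen part of [U]: the closure of a
    small connected neighbourhood can be adjoined to any continuum that meets it. *)
Lemma open_connected_continuum U a b : open U -> connected U -> U a -> U b ->
  exists K, [/\ closed K, connected K, K `<=` U, K a & K b].
Proof.
move=> oU cU Ua Ub.
pose A := [set b | exists K, [/\ closed K, connected K, K `<=` U, K a & K b]].
have extend x : U x -> exists V, [/\ open V, V x, V `<=` U &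
    forall y z, V y -> V z -> A y -> A z].
  move=> Ux; have [V [oV cV Vx VU]] := nbhs_closed_connected (open_nbhs_nbhs (conj oU Ux)).
  exists V; split => // [y Vy|y z Vy Vz [K [clK cK KU Ka Ky]]].
    by apply: VU; exact: subset_closure.
  exists (K `|` closure V); split.
  - by apply: closedU => //; exact: closed_closure.
  - apply: connectedU => //; last exact: connected_closure.
    by exists y; split => //; exact: subset_closure.
  - by rewrite subUset.
  - by left.
  - by right; exact: subset_closure.
have AU : A `<=` U by move=> x [K [_ _ KU _]]; exact: KU.
suff : U `<=` A by apply.
apply: connected_clopen_sub => //.
- have Aa : A a.
    exists [set a]; split => //; last by move=> _ ->.
      exact/accessible_closed_set1/hausdorff_accessible.
    exact: connected1.
  by exists a.
- rewrite openE => x Ax; have [V [oV Vx VU VA]] := extend x (AU _ Ax).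
  by apply: filterS (open_nbhs_nbhs (conj oV Vx)) => y Vy; exact: VA Ax.
- move=> x [Ux clAx]; have [V [oV Vx VU VA]] := extend x Ux.
  have [y [Ay Vy]] := clAx _ (open_nbhs_nbhs (conj oV Vx)).
  exact: VA Ay.
Qed.

Hypothesis X_unicoherent : hereditarily_unicoherent X.

(* The intersection of all continua joining [a] to [b] is connected, because
   these continua form a filter base; and it lies in every connected set [A]
   containing [a] and [b], since for [p] outside [A] the component of
   [X \ {p}] around [A] already contains such a continuum. *)
Lemma connectedI_unicoherent A B : connected A -> connected B -> connected (A `&` B).
Proof.
move=> cA cB; apply: connected_pairwise => a b [Aa Ba] [Ab Bb].
pose F : set (set X) := [set K | [/\ closed K, connected K, K a & K b]].
have sub C : connected C -> C a -> C b -> \bigcap_(K in F) K `<=` C.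
  move=> cC Ca Cb p Fp; apply: contrapT => nCp.
  have oU : open (connected_component (~` [set p]) a).
    by apply/open_component/closed_openC/accessible_closed_set1/hausdorff_accessible.
  have CU : C `<=` connected_component (~` [set p]) a.
    by apply: connected_component_max => // y Cy yp; apply: nCp; rewrite -yp.
  have [K [clK cK KU Ka Kb]] :=
    open_connected_continuum oU (@component_connected _ _ _) (CU _ Ca) (CU _ Cb).
  have Kp : K p by exact: Fp.
  exact: (connected_component_sub (KU _ Kp)).
have F_closed : closed (\bigcap_(K in F) K).
  by apply: closed_bigI => K [].
exists (\bigcap_(K in F) K); split; last 2 first.
- by move=> K [].
- by move=> K [].
(* If the intersection splits into [E false] and [E true], normality separates them by an open [P].
   By compactness a single continuum of [F] already avoids the set [D] between them, and it would be
   disconnected. *)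
- apply/connectedP => E [E0 EF [sep1 sep2]].
  have clE i : closed (E i).
    move=> x Ex; have : (\bigcap_(K in F) K) x.
      apply: F_closed; move: x Ex; apply: closureS; rewrite EF.
      by case: i => ?; [right|left].
    rewrite EF; case: i Ex => Ex [] // H.
      by have : set0 x by rewrite -sep2.
    by have : set0 x by rewrite -sep1.
  have E01 : E false `&` E true = set0.
    by apply/seteqP; split => // x [Ef Et]; rewrite -sep1; split => //; exact: subset_closure.
  have [P [oO EO Odisj]] : exists P, [/\ open P, E false `<=` P & closure P `&` E true = set0].
    have nE : set_nbhs (E false) (~` E true).
      apply/set_nbhsP; exists (~` E true); split => //; first exact/closed_openC.
      by move=> x Ef Et; have : set0 x by rewrite -E01.
    have [P /set_nbhsP[P' [oO' EO' P'P]] Odisj] :=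
      compact_normal X_hausdorff X_compact (clE false) nE.
    exists P'; split => //; apply/seteqP; split => // x [Ox Ex].
    by have := Odisj _ (closureS P'P Ox).
  have oO2 : open (~` closure P) by apply/closed_openC/closed_closure.
  pose D := ~` (P `|` ~` closure P).
  have clD : closed D by apply/open_closedC/openU.
  have DE : D `&` \bigcap_(K in F) K = set0.
    apply/seteqP; split => // x [Dx]; rewrite EF => -[Ex|Ex]; apply: Dx.
      by left; exact: EO.
    by right => Ox; have : set0 x by rewrite -Odisj.
  (* Otherwise the traces on [D] of the members of [F] form a filter base, by hereditary
     unicoherence; a cluster point would lie in [D] and in every member of [F]. *)
  have [K FK KD] : exists2 K, F K & K `&` D = set0.
    apply: contrapT => nK.
    have ne K : F K -> K `&` D !=set0.
      by move=> FK; apply/set0P/eqP => KD; apply: nK; exists K.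
    have FT : F [set: X] by split => //; exact: closedT.
    have Fproper : ProperFilter (filter_from F (fun K => K `&` D)).
      apply: filter_from_proper => //; apply: filter_from_filter; first by exists setT.
      move=> K L FK FL; exists (K `&` L); last by move=> x [[]].
      case: FK FL => [clK cK Ka Kb] [clL cL La Lb].
      by split => //; [exact: closedI|exact: X_unicoherent].
    have [p [_ pF]] := @X_compact _ Fproper filterT.
    have pFK K : F K -> closure (K `&` D) p by move=> FK B' pB'; apply: pF => //; exists K.
    suff : set0 p by [].
      rewrite -DE; split.
        by apply: clD; apply: closureS (pFK _ FT) => x [].
      by move=> K FK; have [clK _ _ _] := FK; apply: clK; apply: closureS (pFK _ FK) => x [].
  have KO : K `<=` P \/ K `<=` ~` closure P.
    apply: connected_subset => //; last by case: FK.
      rewrite /separated; split; first by rewrite setICr.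
      apply/seteqP; split => // x [Ox clx]; have [y [ny Oy]] := clx _ (open_nbhs_nbhs (conj oO Ox)).
      exact/ny/subset_closure.
    move=> x Kx; apply: contrapT => nx; have : set0 x by rewrite -KD.
    by [].
  have [[x Ex] [y Ey]] := (E0 true, E0 false).
  have Kx : K x by apply: (_ : (\bigcap_(K in F) K) x); rewrite ?EF; [right|].
  have Ky : K y by apply: (_ : (\bigcap_(K in F) K) y); rewrite ?EF; [left|].
  case: KO => KO.
    by have : set0 x by rewrite -Odisj; split => //; apply/subset_closure/KO.
  by apply: (KO _ Ky); exact/subset_closure/EO.
- by move=> x Fx; split; [exact: sub Fx|exact: sub Fx].
Qed.

(** If [closure C] missed [Y], then [C] would be clopen in [W], hence all of [W]. For uniqueness,
    [C] with two contact points added stays connected and meets [Y] exactly in that pair, which must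
    then be a single point. *)
Lemma component_boundary W Y q : open W -> connected W -> Y !=set0 ->
  Y `<=` W -> connected Y -> W `&` closure Y `<=` Y -> W q -> ~ Y q ->
  let C := connected_component (W `\` Y) q in
  exists e, [/\ Y e, closure C e & forall e', Y e' -> closure C e' -> e' = e].
Proof.
move=> oW cW Y0 YW cY clY Wq nYq C.
have cC : connected C by exact: component_connected.
have oWY : open (W `\` Y).
  rewrite (_ : _ `\` _ = W `&` ~` closure Y).
    by apply: openI => //; apply/closed_openC/closed_closure.
  apply/seteqP; split => x [Wx nx]; split => // Yx; apply: nx; first exact: clY.
  exact: subset_closure.
have oC : open C by exact: open_component.
have [e [Ye Ce]] : exists e, Y e /\ closure C e.
  apply: contrapT => nYC; have [y Yy] := Y0.
  suff WC : W `<=` C by have [] := connected_component_sub (WC _ (YW _ Yy)).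
  apply: connected_clopen_sub => //.
    by exists q; split => //; apply: connected_component_refl.
  move=> x [Wx Cx]; exists (C `|` [set x]); last by right.
  split; first by left; exact: connected_component_refl.
    move=> z [/connected_component_sub//|->]; split => // Yx.
    by apply: nYC; exists x.
  exact: connected_setU1.
exists e; split => // e' Ye' Ce'; apply: connected_hausdorff_pair => //.
have cCe : connected (C `|` [set e'; e]).
  apply: connected_between cC _ _; first by move=> z; left.
  by move=> z [Cz|[->//|->//]]; exact: subset_closure.
have := connectedI_unicoherent cCe cY.
rewrite (_ : _ `&` Y = [set e'; e])//; apply/seteqP; split => z.
  by case=> [[/connected_component_sub[]//|//]].
by move=> zE; split; [right|case: zE => ->].
Qed.

End LocallyConnected.
End ConnectedSets.

(** * The modulus of complex numbers *)

Section Modulus.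
Variable R : realType.
Implicit Types (z : CC R) (e : R).

Lemma modulus_ge0 z : 0 <= modulus z.
Proof. by rewrite -lecR modulusE; exact: normr_ge0. Qed.

Lemma modulusD (z1 z2 : CC R) : modulus (z1 + z2) <= modulus z1 + modulus z2.
Proof. by rewrite -lecR rmorphD /= !modulusE; exact: ler_normD. Qed.

Lemma modulusN z : modulus (- z) = modulus z.
Proof. by rewrite /modulus normrN. Qed.

Lemma modulusBC (z1 z2 : CC R) : modulus (z1 - z2) = modulus (z2 - z1).
Proof. by rewrite -modulusN opprB. Qed.

Lemma modulus_triangle (z2 z1 z3 : CC R) :
  modulus (z1 - z3) <= modulus (z1 - z2) + modulus (z2 - z3).
Proof. by rewrite -[z1 - z3](subrKA z2) modulusD. Qed.

Lemma modulusM (z1 z2 : R[i]) : modulus (z1 * z2 : CC R) = modulus z1 * modulus z2.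
Proof. by apply: complexI; rewrite rmorphM /= !modulusE normrM. Qed.

Lemma modulusV (z : R[i]) : modulus (z^-1 : CC R) = (modulus z)^-1.
Proof. by apply: complexI; rewrite fmorphV /= !modulusE normfV. Qed.

Lemma modulus0 : modulus (0 : CC R) = 0.
Proof. by rewrite /modulus normr0. Qed.

Lemma modulus_eq0 z : modulus z = 0 -> z = 0.
Proof. by move=> z0; apply/normr0_eq0; rewrite -modulusE z0. Qed.

Lemma modulus_gt0 z : z != 0 -> 0 < modulus z.
Proof.
move=> z0; rewrite lt_neqAle modulus_ge0 andbT eq_sym.
by apply: contra z0 => /eqP/modulus_eq0 ->.
Qed.

Lemma ler_dist_modulus (z1 z2 : CC R) :
  `|modulus z1 - modulus z2| <= modulus (z1 - z2).
Proof.
have h1 : modulus z1 <= modulus (z1 - z2) + modulus z2.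
  by rewrite -{1}[z1](subrK z2) modulusD.
have h2 : modulus z2 <= modulus (z1 - z2) + modulus z1.
  by rewrite modulusBC -{1}[z2](subrK z1) modulusD.
by rewrite ler_norml; apply/andP; split; lra.
Qed.

Lemma cvg_modulusP {T : Type} {F : set_system T} {FF : Filter F} (f : T -> CC R) z :
  f @ F --> z <-> forall e, 0 < e -> \forall t \near F, modulus (f t - z) < e.
Proof.
split=> [/cvgrPdist_lt fz e e0|fz].
  have := fz e%:C%C; rewrite ltcR => /(_ e0).
  by apply: filterS => t; rewrite -modulusE ltcR modulusBC.
apply/cvgrPdist_lt => e e0.
have er : (complex.Re e)%:C%C = e by rewrite RRe_real// gtr0_real.
have := fz (complex.Re e); rewrite -ltcR er => /(_ e0).
by apply: filterS => t; rewrite -ltcR modulusE er distrC.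
Qed.

Lemma nbhs_modulusP z (A : set (CC R)) :
  nbhs z A <-> exists2 e, 0 < e & forall t, modulus (t - z) < e -> A t.
Proof.
split=> [/nbhs_ballP[e /= e0 eA]|[e e0 eA]].
  have er : (complex.Re e)%:C%C = e by rewrite RRe_real// gtr0_real.
  exists (complex.Re e); first by rewrite -ltcR er.
  by move=> t; rewrite -ltcR er modulusE distrC => te; apply: eA; rewrite -ball_normE.
apply/nbhs_ballP; exists e%:C%C; first by rewrite /= ltcR.
by move=> t; rewrite -ball_normE /= -modulusE ltcR modulusBC; exact: eA.
Qed.

Lemma modulusB_continuous z : continuous (fun t : CC R => modulus (t - z)).
Proof.
move=> t; apply/(@cvgrPdist_lt _ _ _ (nbhs (t : CC R))) => e e0.
apply/nbhs_modulusP; exists e => // u; apply: le_lt_trans.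
rewrite distrC; apply: le_trans (ler_dist_modulus _ _) _.
by rewrite opprB addrA subrK.
Qed.

Lemma modulus_Re_Im (x y : R) : modulus (x +i* y : CC R)%C <= `|x| + `|y|.
Proof.
rewrite /modulus normc_def /= -[leRHS]ger0_norm ?addr_ge0//.
rewrite -sqrtr_sqr ler_sqrt ?sqr_ge0// -(real_normK (num_real x)).
rewrite -[y ^+ 2](real_normK (num_real y)) sqrrD lerD2r lerDl.
by rewrite mulrn_wge0// mulr_ge0.
Qed.

Lemma Re_le_modulus z : `|complex.Re z| <= modulus z.
Proof.
rewrite /modulus normc_def /= -[`|_|]sqrtr_sqr ler_sqrt ?addr_ge0 ?sqr_ge0//.
by rewrite ler_wpDr ?sqr_ge0// exprM.
Qed.

Lemma Im_le_modulus z : `|complex.Im z| <= modulus z.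
Proof.
rewrite /modulus normc_def /= -[`|_|]sqrtr_sqr ler_sqrt ?addr_ge0 ?sqr_ge0//.
by rewrite ler_wpDl ?sqr_ge0// exprM.
Qed.

(** The disc is a closed subset of the continuous image of a product of two segments. *)
Lemma compact_disc (z : CC R) (M : R) : compact [set t : CC R | modulus (t - z) <= M].
Proof.
pose f (p : R * R) : CC R := z + (p.1 +i* p.2)%C.
have cf : continuous f.
  move=> p; apply/cvg_modulusP => e e0.
  have e20 : 0 < e / 2 by rewrite divr_gt0.
  have /cvgrPdist_lt/(_ _ e20) c1 : (fun q : R * R => q.1) @ p --> p.1 by exact: cvg_fst.
  have /cvgrPdist_lt/(_ _ e20) c2 : (fun q : R * R => q.2) @ p --> p.2 by exact: cvg_snd.
  near=> q; rewrite /f opprD addrACA subrr add0r.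
  have -> : (q.1 +i* q.2 - p.1 +i* p.2 = (q.1 - p.1) +i* (q.2 - p.2))%C by [].
  apply: le_lt_trans (modulus_Re_Im _ _) _.
  rewrite [ltRHS]splitr ltrD// distrC; near: q; [exact: c1|exact: c2].
apply: (@subclosed_compact _ _ (f @` (`[- M, M] `*` `[- M, M]))).
- apply: (@closed_comp _ _ (fun t : CC R => modulus (t - z)) [set x | x <= M]).
    by move=> t _; exact: modulusB_continuous.
  exact: closed_le.
- apply: continuous_compact; first exact: continuous_subspaceT.
  by apply: compact_setX; exact: segment_compact.
- move=> t /= tM; exists (complex.Re (t - z), complex.Im (t - z)).
    split => /=; rewrite in_itv /= -ler_norml; apply: le_trans tM.
      exact: Re_le_modulus.
    exact: Im_le_modulus.
  rewrite -[LHS]/(z + (complex.Re (t - z) +i* complex.Im (t - z))%C).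
  by case E : (t - z) => [x y] /=; rewrite -E addrC subrK.
Unshelve. all: by end_near. Qed.

End Modulus.

(** * Lifting a family of zeros *)

Section Lifting.
Variables (R : realType) (X : topologicalType).
Hypothesis X_compact : compact [set: X].
Hypothesis X_hausdorff : hausdorff_space X.
Hypothesis X_connected : connected [set: X].
Hypothesis X_lc : locally_connected X.
Hypothesis X_unicoherent : hereditarily_unicoherent X.

Variable Z : X -> CC R -> Prop.
Implicit Types (Y V W : set X) (w : X -> CC R) (D : set (CC R)).

Definition cont_on Y w := forall x, Y x -> forall e : R, 0 < e ->
  \forall t \near x, Y t -> modulus (w t - w x) < e.

Definition lift Y D w := cont_on Y w /\ forall x, Y x -> D (w x) /\ Z x (w x).

Definition disc (c : CC R) (r : R) : set (CC R) := [set z | modulus (z - c) < r].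

Hypothesis Z_closed : forall x z, ~ Z x z ->
  \forall z' \near z & t \near x, ~ Z t z'.

(** The second half records that zeros persist over [V]. With [V] a singleton this becomes a
    property of points, which can be required near a given point. *)
Definition isolating (V : set X) (c : CC R) (r : R) :=
  forall t, V t -> (forall z, Z t z -> modulus (z - c) != r) /\
                   (exists z, Z t z /\ disc c r z).

Hypothesis Z_isolating : forall x z e, Z x z -> 0 < e ->
  exists r, [/\ 0 < r, r <= e & \forall t \near x, isolating [set t] z r].

Lemma cont_on_subset Y Y' w : Y `<=` Y' -> cont_on Y' w -> cont_on Y w.
Proof.
move=> YY' cw x Yx e e0; apply: filterS (cw x (YY' _ Yx) e e0) => t + Yt.
by apply; exact: YY'.
Qed.

(** By continuity, the points of [Y] with values inside and outside the avoided circle form a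
    separation. *)
Lemma connected_disc Y w c r x y : connected Y -> cont_on Y w ->
  (forall x, Y x -> modulus (w x - c) != r) ->
  Y x -> Y y -> disc c r (w x) -> disc c r (w y).
Proof.
move=> cY cw wr Yx Yy wx.
pose E (b : bool) : set X :=
  if b then [set t | Y t /\ modulus (w t - c) > r]
  else [set t | Y t /\ modulus (w t - c) < r].
have YE : Y `<=` E false `|` E true.
  move=> t Yt; have := wr t Yt; rewrite neq_lt => /orP[] ?; [left|right] => //.
have sep : separated (E false) (E true).
  split; apply/seteqP; split => // t.
  - move=> [clt [Yt /= rt]].
    have e0 : 0 < modulus (w t - c) - r by rewrite subr_gt0.
    have [u [[Yu ur] /(_ Yu) ut]] := clt _ (cw t Yt _ e0).
    have := modulus_triangle (w u) (w t) c; rewrite (modulusBC (w t) (w u)).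
    by move: ur ut => /=; lra.
  - move=> [[Yt /= rt] clt].
    have e0 : 0 < r - modulus (w t - c) by rewrite subr_gt0.
    have [u [[Yu ur] /(_ Yu) ut]] := clt _ (cw t Yt _ e0).
    have := modulus_triangle (w t) (w u) c.
    by move: ur ut => /=; lra.
have [H|H] := connected_subset sep YE cY; first by have [] := H _ Yy.
by have [_ /=] := H _ Yx; move: wx; rewrite /disc /= => /lt_trans/[apply]; rewrite ltxx.
Qed.

(* A connected family of roots cannot cross the circle of radius [r] provided
   by [Z_isolating]; so a cluster value of [w] at [x] that is a root is a limit. *)
Lemma cluster_root_limit Y w x z : connected Y -> lift Y setT w -> Z x z ->
  (forall V e, nbhs x V -> 0 < e -> exists t, [/\ V t, Y t & disc z e (w t)]) ->
  forall e, 0 < e -> \forall t \near x, Y t -> disc z e (w t).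
Proof.
move=> cY [cw wZ] Zxz wz e e0.
have [r [r0 re Vr]] := Z_isolating Zxz e0.
have [V [oV cV Vx VP]] := X_lc Vr.
have [s [Vs Ys ws]] := wz V r (open_nbhs_nbhs (conj oV Vx)) r0.
have cVY : connected (V `&` Y) by exact: connectedI_unicoherent.
apply: filterS (open_nbhs_nbhs (conj oV Vx)) => t Vt Yt.
apply: lt_le_trans re.
apply: (@connected_disc (V `&` Y) w z r s t) => //.
  by apply: cont_on_subset cw => u [].
move=> u [Vu Yu]; have [+ _] := VP u Vu u erefl; apply.
by have [] := wZ u Yu.
Qed.

(** The bounded values of [w] near [x] generate a filter on a compact disc; its cluster point is a
    root because the zero set is closed. *)
Lemma bounded_cluster_root Y w x (M : R) : lift Y setT w ->
  (forall V, nbhs x V -> exists t, [/\ V t, Y t & modulus (w t) <= M]) ->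
  exists z, Z x z /\
    (forall V e, nbhs x V -> 0 < e -> exists t, [/\ V t, Y t & disc z e (w t)]).
Proof.
move=> [cw wZ] wM.
pose B (V : set X) := [set z : CC R | exists t, [/\ V t, Y t, modulus (w t) <= M & z = w t]].
have FB : ProperFilter (filter_from (nbhs x) B).
  apply: filter_from_proper; last first.
    by move=> V /wM[t [Vt Yt tM]]; exists (w t), t.
  apply: filter_from_filter; first by exists setT; exact: filterT.
  move=> U V xU xV; exists (U `&` V); first exact: filterI.
  by move=> z [t [[Ut Vt] Yt tM zt]]; split; exists t.
have [|z [_ Bz]] := @compact_disc R 0 M _ FB.
  by exists setT; [exact: filterT|move=> _ [t [_ _ tM ->]] /=; rewrite subr0].
have Bze V e : nbhs x V -> 0 < e -> exists t, [/\ V t, Y t & disc z e (w t)].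
  move=> xV e0; have [| |_ [[t [Vt Yt _ ->]] wte]] := Bz (B V) (disc z e).
  - by exists V.
  - by apply/nbhs_modulusP; exists e.
  - by exists t.
exists z; split => //; apply: contrapT => nZ.
have [[P Q] /= [/nbhs_modulusP[e e0 eP] xQ] PQ] := Z_closed nZ.
have [t [Qt Yt te]] := Bze Q e xQ e0.
by have [_] := wZ t Yt; apply: (PQ (w t, t)); split => //; exact: eP.
Qed.

(** Lifts are encoded as graphs so that [Zorn_bigcup] applies to their inclusion order. *)
Definition graph_on Y w : set (X * CC R) := [set p | Y p.1 /\ p.2 = w p.1].

(** The domains need not be open, so continuity of the union is not inherited from the members. It
    holds because any two points of the union lie in a common member, whose values near [x] are
    trapped in an isolating disc. The condition at [a] is restricted to nonempty domains since the
    empty chain has an empty union. *)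
Lemma lift_bigcup (F : set (set (X * CC R))) W D a b :
  (forall G, F G -> exists Y w, [/\ G = graph_on Y w, Y `<=` W, connected Y,
     lift Y D w & Y !=set0 -> Y a /\ w a = b]) ->
  total_on F subset ->
  exists Y w, [/\ \bigcup_(G in F) G = graph_on Y w, Y `<=` W, connected Y,
     lift Y D w & Y !=set0 -> Y a /\ w a = b].
Proof.
move=> FG tF.
pose dom (G : set (X * CC R)) := [set x | exists z, G (x, z)].
pose Y := \bigcup_(G in F) dom G.
have /choice[w wF] : forall x, exists z, Y x -> exists2 G, F G & G (x, z).
  move=> x; have [[G FG' [z Gz]]|nY] := pselect (Y x); last by exists 0.
  by exists z => _; exists G.
have GE G : F G -> G = graph_on (dom G) w.
  move=> FG'; apply/seteqP; split => [[x z] Gxz|[x z] [/= [z' Gxz'] ->]].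
    have Yx : Y x by exists G => //; exists z.
    split => /=; first by exists z.
    have [H FH Hxw] := wF x Yx.
    have [GH|HG] := tF _ _ FG' FH.
      have [Y' [w' [HE _ _ _ _]]] := FG H FH.
      by move: (GH _ Gxz) Hxw; rewrite HE => -[/= _ ->] [/= _ ->].
    have [Y' [w' [GE _ _ _ _]]] := FG G FG'.
    by move: (HG _ Hxw) Gxz; rewrite GE => -[/= _ ->] [/= _ ->].
  have Yx : Y x by exists G => //; exists z'.
  have [H FH Hxw] := wF x Yx.
  have [GH|HG] := tF _ _ FG' FH; last exact: HG.
  have [Y' [w' [HE _ _ _ _]]] := FG H FH.
  by move: (GH _ Gxz') Hxw (Gxz'); rewrite HE => -[/= _ ->] [/= _ ->].
have domE G : F G -> [/\ dom G `<=` W, connected (dom G), lift (dom G) D w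
    & dom G !=set0 -> dom G a /\ w a = b].
  move=> FG'; have [Y' [w' [G' YW cY [cw wZ] Ya]]] := FG G FG'.
  have YE : Y' = dom G.
    apply/seteqP; split => x; first by move=> Yx; exists (w' x); rewrite G'.
    by move=> [z]; rewrite G' => -[].
  have ww x : Y' x -> w' x = w x.
    move=> Yx; have : G (x, w' x) by rewrite G'.
    by rewrite {1}(GE G FG') => -[].
  rewrite -YE; split => //; last by move=> /Ya[? <-]; rewrite ww.
  split; last by move=> x Yx; rewrite -ww//; exact: wZ.
  move=> x Yx e e0; apply: filterS (cw x Yx e e0) => t + Yt.
  by rewrite !ww//; apply.
exists Y, w.
have cY : connected Y.
  rewrite (_ : Y = \bigcup_(A in dom @` F) A).
    apply: bigcup_total_connected; last by move=> _ [G FG' <-]; have [] := domE G FG'.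
    move=> _ _ [G FG' <-] [H FH <-]; have [GH|HG] := tF _ _ FG' FH; [left|right].
      by move=> x [z /GH Hz]; exists z.
    by move=> x [z /HG Hz]; exists z.
  by rewrite bigcup_image.
split => //.
- apply/seteqP; split => [[x z] [G FG' Gxz]|[x z] [/= Yx ->]].
    split => /=; first by exists G => //; exists z.
    by move: Gxz; rewrite (GE G FG') => -[].
  by have [G FG' ?] := wF x Yx; exists G.
- by move=> x [G FG' Gx]; have [+ _ _ _] := domE G FG'; apply.
- have wZ x : Y x -> D (w x) /\ Z x (w x).
    by move=> [G FG' Gx]; have [_ _ [_ +] _] := domE G FG'; apply.
  split => // x Yx e e0.
  have [_ Zx] := wZ x Yx.
  have [r [r0 re Vr]] := Z_isolating Zx e0.
  have [V [oV cV Vx VP]] := X_lc Vr.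
  apply: filterS (open_nbhs_nbhs (conj oV Vx)) => t Vt Yt.
  have [G FG' [Gx Gt]] : exists2 G, F G & dom G x /\ dom G t.
    have [[G FG' Gx] [H FH Ht]] := (Yx, Yt).
    have [GH|HG] := tF _ _ FG' FH; [exists H|exists G] => //; split => //.
      by case: Gx => z /GH; exists z.
    by case: Ht => z /HG; exists z.
  have [_ cG [cw _] _] := domE G FG'.
  apply: lt_le_trans re.
  apply: (@connected_disc (V `&` dom G) w (w x) r x t) => //.
  + exact: connectedI_unicoherent.
  + by apply: cont_on_subset cw => u [].
  + move=> u [Vu Gu]; have [+ _] := VP u Vu u erefl; apply.
    by have [] : D (w u) /\ Z u (w u) by apply: wZ; exists G.
  + by rewrite /disc /= subrr modulus0.
- by move=> [x [G FG' Gx]]; have [_ _ _ []] := domE G FG'; [exists x|split => //; exists G].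
Qed.

(** The Zorn argument, abstracted from the reasons for local liftability and for limits at closure
    points: it is applied with [D] a disc inside the induction of [lift_disc], and with [D] the
    whole plane in [global_lift]. *)
Lemma lift_extension W D a b : open W -> connected W -> W a -> D b -> Z a b ->
  (forall x z, W x -> D z -> Z x z ->
     exists V w, [/\ nbhs x V, connected V, lift V D w & w x = z]) ->
  (forall Y w x, Y `<=` W -> connected Y -> lift Y D w -> W x -> closure Y x ->
     exists z, [/\ D z, Z x z &
       forall e, 0 < e -> \forall t \near x, Y t -> disc z e (w t)]) ->
  exists w, lift W D w /\ w a = b.
Proof.
move=> oW cW Wa Db Zab W_local W_closed.
pose P (G : set (X * CC R)) := exists Y w, [/\ G = graph_on Y w, Y `<=` W,
  connected Y, lift Y D w & Y !=set0 -> Y a /\ w a = b].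
have [G [[Y [w [GE YW cY [cw wZ] Yab]]] Gmax]] : exists G, P G /\ forall H, G `<` H -> ~ P H.
  by apply: Zorn_bigcup => F FP tF; exact: lift_bigcup.
have maxY Y' w' : Y `<=` Y' -> (forall x, Y x -> w' x = w x) -> Y' `<=` W ->
    connected Y' -> lift Y' D w' -> (Y' !=set0 -> Y' a /\ w' a = b) -> Y' `<=` Y.
  move=> YY' ww' Y'W cY' lY' Y'ab; apply: contrapT => nY'Y.
  apply: (Gmax (graph_on Y' w')); last by exists Y', w'.
  split; first by rewrite GE => -[x z] [/= Yx ->]; split => /=; [exact: YY'|rewrite ww'].
  rewrite GE => sub; apply: nY'Y => x Y'x.
  by have [] : graph_on Y w (x, w' x) by apply: sub; split.
have aa : lift [set a] D (fun=> b).
  split=> [x _ e e0|x ->//]; apply: nearW => t _.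
  by rewrite subrr modulus0.
have Y0 : Y !=set0.
  apply: contrapT => nY; have nYx x : ~ Y x by move=> Yx; apply: nY; exists x.
  apply: (nYx a); apply: (maxY [set a] (fun=> b)) => //.
  - by move=> x /nYx.
  - by move=> x /nYx.
  - by move=> _ ->.
  - exact: connected1.
have {Yab} [Ya wa] := Yab Y0.
(* A limit root at a closure point outside [Y] would extend the lift by one point. *)
have clY : W `&` closure Y `<=` Y.
  move=> x [Wx clx]; apply: contrapT => nYx.
  have [z [Dz Zxz wz]] := W_closed Y w x YW cY (conj cw wZ) Wx clx.
  pose w' t := if t == x then z else w t.
  have ww' t : Y t -> w' t = w t.
    by move=> Yt; rewrite /w'; case: eqP => // tx; move: nYx; rewrite -tx.
  have w'x : w' x = z by rewrite /w' eqxx.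
  apply: (nYx); apply: (maxY (Y `|` [set x]) w') => //.
  - by move=> t [/YW//|->].
  - exact: connected_setU1.
  - split; last by move=> t [Yt|->]; [rewrite ww'//; exact: wZ|rewrite w'x].
    move=> t [Yt|->] e e0; last first.
      apply: filterS (wz e e0) => u Yu [Yu'|->]; last by rewrite subrr modulus0.
      by rewrite w'x ww'//; exact: Yu.
    have nx : \forall u \near t, u != x.
      apply: open_nbhs_nbhs; split; last by apply/eqP => tx; move: nYx; rewrite -tx.
      rewrite (_ : (fun u => _) = ~` [set x]).
        exact/closed_openC/accessible_closed_set1/hausdorff_accessible.
      by apply/seteqP; split => u /eqP.
    apply: filterS2 nx (cw t Yt e e0) => u /eqP ux + [Yu|//].
    by rewrite !ww'//; apply.
  - by rewrite ww'//; split => //; left.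
  - by right.
have [YW'|/existsNP[q /not_implyP[Wq nYq]]] := pselect (W `<=` Y).
  exists w; split => //; split; last by move=> x /YW'; exact: wZ.
  exact: cont_on_subset cw.
have [e [Ye Ce Ce']] := component_boundary X_lc X_connected X_compact X_hausdorff
  X_unicoherent oW cW Y0 YW cY clY Wq nYq.
set C := connected_component (W `\` Y) q in Ce Ce'.
have CWY : C `<=` W `\` Y by exact: connected_component_sub.
have oC : open C.
  apply: (open_component X_lc); rewrite (_ : _ `\` _ = W `&` ~` closure Y).
    by apply: openI => //; apply/closed_openC/closed_closure.
  apply/seteqP; split => x [Wx nx]; split => // Yx; apply: nx; first exact: clY.
  exact: subset_closure.
have [De Ze] := wZ e Ye.
have [V [w2 [eV cV [cw2 w2Z] w2e]]] := W_local e (w e) (YW _ Ye) De Ze.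
(* The local lift is used on [C] and the old one elsewhere; they agree at [e], the only point of [Y]
   where [C] accumulates. *)
pose w' t := if t \in C then w2 t else w t.
have ww' t : Y t -> w' t = w t.
  by move=> Yt; rewrite /w'; case: ifPn => // /set_mem/CWY[].
have w2w' t : C t -> w' t = w2 t by move=> Ct; rewrite /w' mem_set.
have clVC : closure (V `&` C) e.
  move=> U eU; have [t [Ct [Ut Vt]]] := Ce _ (filterI eU eV).
  by exists t.
have [t [Ct Vt]] := Ce _ eV.
suff VCY : V `&` C `<=` Y by have [_ []] := CWY _ Ct; apply: VCY.
apply: (subset_trans (@subsetUr _ Y _)).
apply: (maxY (Y `|` V `&` C) w') => //.
- by move=> x [/YW//|[_ /CWY[]]].
- have -> : Y `|` V `&` C = Y `|` ((V `&` C) `|` [set e]).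
    by rewrite setUA; apply/esym/setUidl => _ ->; left.
  apply: connectedU => //; first by exists e; split => //; right.
  apply: connected_setU1 => //; apply: connectedI_unicoherent => //.
  exact: component_connected.
- split; last first.
    by move=> x [Yx|[Vx Cx]]; [rewrite ww'//; exact: wZ|rewrite w2w'//; exact: w2Z].
  move=> x [Yx|[Vx Cx]] d d0; last first.
    apply: filterS2 (open_nbhs_nbhs (conj oC Cx)) (cw2 x Vx d d0) => u Cu.
    move=> + [Yu|[Vu _]]; first by have [] := CWY _ Cu.
    by rewrite !w2w'//; apply.
  have [Cx|nCx] := pselect (closure C x).
    have xe := Ce' x Yx Cx; rewrite xe in Yx Cx *.
    apply: filterS2 (cw e Ye d d0) (cw2 e (nbhs_singleton eV) d d0) => u.
    move=> H1 H2 [Yu|[Vu Cu]]; first by rewrite !ww'//; exact: H1.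
    by rewrite w2w'// ww'// -w2e; exact: H2.
  have nC : nbhs x (~` closure C).
    by apply: open_nbhs_nbhs; split => //; apply/closed_openC/closed_closure.
  apply: filterS2 nC (cw x Yx d d0) => u nCu + [Yu|[_ Cu]].
    by rewrite !ww'//; apply.
  by case: nCu; exact: subset_closure.
- by rewrite ww'//; split => //; left.
Qed.

Lemma lift_codom Y D D' w : (forall z, D z -> D' z) -> lift Y D w -> lift Y D' w.
Proof. by move=> DD' [cw wZ]; split => // x /wZ[/DD']. Qed.

(** A cluster value lies in the closed disc, and as a root it cannot lie on the circle. *)
Lemma disc_root_limit Y c r w x : connected Y -> lift Y (disc c r) w ->
  isolating [set x] c r -> closure Y x ->
  exists z, [/\ disc c r z, Z x z &
    forall e, 0 < e -> \forall t \near x, Y t -> disc z e (w t)].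
Proof.
move=> cY lw ix clx; have lT : lift Y setT w by apply: lift_codom lw.
have [_ wZ] := lw.
have [|z [Zxz wz]] := @bounded_cluster_root Y w x (r + modulus c) lT.
  move=> V xV; have [t [Yt Vt]] := clx _ xV; exists t; split => //.
  have [tD _] := wZ t Yt.
  rewrite -[w t](subrK c); apply: le_trans (modulusD _ _) _.
  by rewrite lerD2r ltW.
exists z; split => //; last exact: cluster_root_limit.
rewrite /disc /= lt_neqAle; have [+ _] := ix x erefl; move=> ->//=.
apply/ler_addgt0Pr => e e0.
have [t [_ Yt wte]] := wz setT e filterT e0.
have [tD _] := wZ t Yt.
have := modulus_triangle (w t) z c; rewrite (modulusBC z (w t)).
by move: wte tD; rewrite /disc /=; lra.
Qed.

Lemma lift_disc N V c r a b : open V -> connected V -> isolating V c r ->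
  (forall t s, V t -> uniq s -> (forall z, z \in s -> Z t z /\ disc c r z) ->
     (size s <= N)%N) ->
  V a -> disc c r b -> Z a b -> exists w, lift V (disc c r) w /\ w a = b.
Proof.
elim: N V c r a b => [|N IH] V c r a b oV cV iV countV Va Db Zab.
  suff : (size [:: b] <= 0)%N by [].
  by apply: (countV a) => // z; rewrite inE => /eqP ->.
have V_zero t : V t -> exists z, Z t z /\ disc c r z by move=> /iV[].
pose S := [set t | forall z z', Z t z -> Z t z' -> disc c r z -> disc c r z' -> z = z'].
pose U := V `\` S.
have UP t : U t -> exists z z', [/\ Z t z, Z t z', disc c r z, disc c r z' & z <> z'].
  move=> [_ /existsNP[z /existsNP[z']]].
  do 4 move=> /not_implyP[?]; by exists z, z'.
(* Near a point with at least two zeros, a small disc around one of them misses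
   a zero of the original disc, so it contains at most [N] zeros. *)
have split_zeros t z : U t -> Z t z -> disc c r z ->
    exists z' r1 r2, [/\ 0 < r1, 0 < r2, (forall u, disc z r1 u -> disc c r u),
      (forall u, disc z' r2 u -> disc c r u /\ ~ disc z r1 u) &
      \forall x \near t, isolating [set x] z r1 /\ isolating [set x] z' r2].
  move=> Ut Ztz Dz.
  have [z' [Ztz' Dz' zz']] : exists z', [/\ Z t z', disc c r z' & z <> z'].
    have [z1 [z2 [Z1 Z2 D1 D2 z12]]] := UP t Ut.
    by have [zz1|zz1] := pselect (z = z1); [exists z2; rewrite zz1|exists z1].
  have d0 : 0 < modulus (z' - z).
    by rewrite modulus_gt0// subr_eq0; apply/eqP => /esym.
  (* Half the distance keeps the two small discs apart; the other terms keep them inside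
     [disc c r]. *)
  pose e := Num.min (modulus (z' - z) / 2)
    (Num.min (r - modulus (z - c)) (r - modulus (z' - c))).
  have e0 : 0 < e by rewrite !lt_min divr_gt0//= !subr_gt0; apply/andP.
  have [r1 [r10 r1e near1]] := Z_isolating Ztz e0.
  have [r2 [r20 r2e near2]] := Z_isolating Ztz' e0.
  move: r1e r2e; rewrite !le_min => /and3P[e1 e2 e3] /and3P[e4 e5 e6].
  exists z', r1, r2; split => //.
  - move=> u; rewrite /disc /= => uz.
    by have := modulus_triangle z u c; lra.
  - move=> u; rewrite /disc /= => uz; split.
      by have := modulus_triangle z' u c; lra.
    by have := modulus_triangle u z' z; rewrite (modulusBC z' u); lra.
  - exact: filterS2 near1 near2.
(* Two disjoint isolating discs each keep a zero over nearby points. *)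
have oU : open U.
  rewrite openE => t Ut; have [Vt _] := Ut.
  have [z [_ [Zz _ Dz _ _]]] := UP t Ut.
  have [z' [r1 [r2 [r10 r20 D1 D2 near12]]]] := split_zeros t z Ut Zz Dz.
  apply: filterS2 (open_nbhs_nbhs (conj oV Vt)) near12 => x Vx [i1 i2].
  have [_ [z1 [Z1 d1]]] := i1 x erefl; have [_ [z2 [Z2 d2]]] := i2 x erefl.
  split => // Sx; have [d2' nd2] := D2 _ d2; apply: nd2.
  by rewrite (Sx z2 z1)//; exact: D1.
have U_lift q z : U q -> Z q z -> disc c r z -> exists w,
    lift (connected_component U q) (disc c r) w /\ w q = z.
  move=> Uq Zqz Dz; set W := connected_component U q.
  have WU : W `<=` U by exact: connected_component_sub.
  have oW : open W by exact: open_component.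
  apply: lift_extension => //.
  - exact: component_connected.
  - exact: connected_component_refl.
  - move=> x u Wx Du Zxu.
    have [z' [r1 [r2 [r10 r20 D1 D2 near12]]]] := split_zeros x u (WU _ Wx) Zxu Du.
    have [V1 [oV1 cV1 V1x V1P]] := X_lc (filterI (open_nbhs_nbhs (conj oW Wx)) near12).
    have [|t s V1t us sP||||w [lw wx]] := IH V1 u r1 x u oV1 cV1 => //.
    + by move=> t /V1P[_ [i1 _]]; exact: i1.
    (* The zero [z2] is outside the small disc, so [z2 :: s] has at most [N.+1] elements and [s] at
       most [N]. *)
    + have [Wt [_ i2]] := V1P _ V1t; have [_ [z2 [Z2 d2]]] := i2 t erefl.
      have [d2' nd2] := D2 _ d2; rewrite -ltnS; apply: (countV t (z2 :: s)).
      * by have [] := WU _ Wt.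
      * by rewrite /= us andbT; apply/negP => /sP[_ /nd2].
      * by move=> y; rewrite inE => /orP[/eqP ->//|/sP[? /D1]].
    + by rewrite /disc /= subrr modulus0.
    + exists V1, w; split => //; first exact: open_nbhs_nbhs.
      exact: lift_codom lw.
  - move=> Y w x YW cY lw Wx clx; apply: disc_root_limit => //.
    by move=> _ ->; apply: iV; have [] := WU _ Wx.
(* Lifts are indexed by components as sets, so that the choice does not depend on a base point; the
   component of [a], if any, gets a lift through [b]. *)
have /choice[wU wUP] : forall K : set X, exists w, forall q, U q ->
    K = connected_component U q ->
    lift K (disc c r) w /\ (K a -> w a = b).
  move=> K; have [[q [Uq KE]]|nK] := pselect (exists q, U q /\ K = connected_component U q);
    last by exists (fun=> 0) => q Uq KE; case: nK; exists q.
  have [Ka|nKa] := pselect (K a).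
    have Ka' : K = connected_component U a.
      by rewrite KE; apply: same_connected_component; rewrite -KE.
    have [|w [lw wa]] := U_lift a b _ Zab Db.
      by apply: (@connected_component_sub _ U q); rewrite -KE.
    by exists w => q' _ _; rewrite Ka'.
  have [Vq _] := Uq; have [z [Zqz Dz]] := V_zero q Vq.
  have [w [lw _]] := U_lift q z Uq Zqz Dz.
  by exists w => q' _ _; rewrite KE; split => //; rewrite -KE.
have /choice[h hP] : forall t, exists z, V t -> Z t z /\ disc c r z.
  move=> t; have [/V_zero[z ?]|nVt] := pselect (V t); first by exists z.
  by exists 0.
pose w t := if t \in U then wU (connected_component U t) t else h t.
have w_comp q t : U q -> connected_component U q t ->
    w t = wU (connected_component U q) t.
  move=> Uq Ct; rewrite /w mem_set; last exact: connected_component_sub Ct.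
  by rewrite (same_connected_component Ct).
have wZ t : V t -> disc c r (w t) /\ Z t (w t).
  move=> Vt; have [Ut|nUt] := pselect (U t).
    have [[_ wUZ] _] := wUP _ t Ut erefl.
    rewrite (w_comp t t)//; last exact: connected_component_refl.
    by apply: wUZ; exact: connected_component_refl.
  by rewrite /w memNset//; have [] := hP t Vt.
exists w; split; last first.
  have [Ua|nUa] := pselect (U a).
    have [_ +] := wUP _ a Ua erefl.
    have aa := connected_component_refl Ua.
    by rewrite (w_comp a a)//; apply.
  have Sa : S a by apply: contrapT => nSa; apply: nUa.
  by have [Da Za] := wZ a Va; apply: Sa.
split => // t Vt e e0.
have [Ut|nUt] := pselect (U t).
  have tt := connected_component_refl Ut.
  have oC : open (connected_component U t) by exact: open_component.
  have [[cwU _] _] := wUP _ t Ut erefl.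
  apply: filterS2 (open_nbhs_nbhs (conj oC tt)) (cwU t tt e e0) => u Cu + _.
  by rewrite !(w_comp t)//; apply.
have St : S t by apply: contrapT => nSt; apply: nUt.
have [Dwt Zwt] := wZ t Vt.
(* Over [t], where the zero is unique, [K] contains no zero. By compactness this persists nearby, so
   there all zeros of the disc are within [e] of [w t], whichever was chosen. *)
pose K := [set z | modulus (z - c) <= r] `&` [set z | e <= modulus (z - w t)].
have cK : compact K.
  apply: compact_closedI; first exact: compact_disc.
  apply: (@closed_comp _ _ (fun z => modulus (z - w t)) [set x | e <= x]).
    by move=> z _; exact: modulusB_continuous.
  exact: closed_ge.
have K_nozero z : K z -> ~ Z t z.
  move=> [zc zw] Ztz; have [+ _] := iV t Vt; move=> /(_ z Ztz) zr.
  have Dz : disc c r z by rewrite /disc /= lt_neqAle zr.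
  by move: zw; rewrite /= (St z (w t))// subrr modulus0 leNgt e0.
have near_K : \forall x \near t, K `<=` (fun z => ~ Z x z).
  have /compact_near_coveringP := cK.
  by apply => z /K_nozero; exact: Z_closed.
apply: filterS near_K => x Kx Vx; rewrite ltNge; apply/negP => ew.
have [Dx Zx] := wZ x Vx.
by apply: (Kx (w x)) => //; split => //=; exact: ltW.
Qed.

Hypothesis Z_finite : forall (x : X) (c : CC R) (r : R), exists N, \forall t \near x, forall s,
  uniq s -> (forall z, z \in s -> Z t z /\ disc c r z) -> (size s <= N)%N.

(** The absence of asymptotic roots, in positive form: [w] takes bounded values arbitrarily near
    [x]. *)
Hypothesis Z_no_asymptotic : forall Y w (x : X), connected Y -> lift Y setT w ->
  closure Y x -> ~ Y x ->
  exists M, forall V, nbhs x V -> exists t, [/\ V t, Y t & modulus (w t) <= M].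

Lemma global_lift a b : Z a b -> exists w, lift setT setT w /\ w a = b.
Proof.
move=> Zab; apply: lift_extension => //; first exact: openT.
- move=> x z _ _ Zxz; have [r [r0 _ near1]] := Z_isolating Zxz ltr01.
  have [N near2] := Z_finite x z r.
  have [V [oV cV Vx VP]] := X_lc (filterI near1 near2).
  have [|||||w [lw wx]] := @lift_disc N V z r x z oV cV => //.
  + by move=> t /VP[+ _]; apply.
  + by move=> t s /VP[_]; apply.
  + by rewrite /disc /= subrr modulus0.
  + by exists V, w; split => //; [exact: open_nbhs_nbhs|exact: lift_codom lw].
- move=> Y w x _ cY lw _ clx.
  have [z [Zxz wz]] : exists z, Z x z /\
    (forall V e, nbhs x V -> 0 < e -> exists t, [/\ V t, Y t & disc z e (w t)]).
    have [Yx|nYx] := pselect (Y x); last first.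
      by have [M MP] := Z_no_asymptotic cY lw clx nYx; exact: bounded_cluster_root MP.
    have [_ /(_ x Yx)[_ Zx]] := lw; exists (w x); split => // V e xV e0.
    exists x; split => //; first exact: nbhs_singleton.
    by rewrite /disc /= subrr modulus0.
  by exists z; split => //; exact: cluster_root_limit.
Qed.

End Lifting.

(** * Goursat's lemma and the mean value bound *)

Section Flux.
Variable R : realType.
Local Open Scope complex_scope.

(** The integral is based at [K], so the derivative is obtained only to the right of [K]; users
    place [K] left of their range. *)
Lemma primitive (f : R -> R) (K : R) : continuous f ->
  exists F : R -> R, forall x, K < x -> is_derive x (1 : R) F (f x).
Proof.
move=> cf; exists (fun x => \int[lebesgue_measure]_(t in `[K, x]) f t)%R => x Kx.
have xx1 : x < x + 1 by rewrite ltrDl.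
have fi : (@lebesgue_measure R).-integrable `[K, x + 1] (EFin \o f).
  apply: continuous_compact_integrable; first exact: segment_compact.
  exact: continuous_subspaceT.
have [dF F'] := continuous_FTC1_closed xx1 fi Kx (cf x).
by rewrite -F' derive1E; exact: derivableP.
Qed.

(** The mean value theorem here plays the role of an estimate on the integral of [f' - k]. *)
Lemma derive_bound (f f' : R -> R) (a b k M : R) : a <= b ->
  (forall x, a <= x <= b -> is_derive x (1 : R) f (f' x)) ->
  (forall x, a <= x <= b -> `|f' x - k| <= M) ->
  `|f b - f a - k * (b - a)| <= M * (b - a).
Proof.
move=> ab df f'M.
have [||c cab ->] := @MVT_segment _ f f' a b ab.
- move=> x; rewrite in_itv /= => /andP[ax xb]; apply: df.
  by rewrite !ltW.
- apply: derivable_within_continuous => x; rewrite in_itv /= => /df.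
  by case.
- rewrite -mulrBl normrM [`|b - a|]ger0_norm ?subr_ge0//.
  by rewrite ler_wpM2r ?subr_ge0//; apply: f'M; rewrite in_itv in cab.
Qed.

(** Caratheodory's form of the complex derivative, for which the chain and product rules are
    algebraic. *)
Definition cderiv (g : CC R -> CC R) (z k : CC R) :=
  exists2 phi : CC R -> CC R, phi t @[t --> z] --> k &
    \forall t \near z, g t - g z = phi t * (t - z).

Lemma cderivP (g : CC R -> CC R) (z k : CC R) :
  cderiv g z k <-> forall e : R, 0 < e -> \forall t \near z,
    modulus (g t - g z - k * (t - z)) <= e * modulus (t - z).
Proof.
split=> [[phi phik gE] e e0|gk].
  have /cvg_modulusP/(_ e e0) phie := phik.
  apply: filterS2 gE phie => t -> /ltW phite.
  by rewrite -mulrBl modulusM ler_wpM2r// modulus_ge0.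
exists (fun t => if t == z then k else (g t - g z) / (t - z)); last first.
  apply/nbhs_modulusP; exists 1 => // t _; case: eqP => [->|/eqP tz]; first by rewrite !subrr mulr0.
  by rewrite divfK// subr_eq0.
apply/(@cvg_modulusP _ _ (nbhs (z : CC R))) => e e0; have e20 : 0 < e / 2 by rewrite divr_gt0.
apply: filterS (gk _ e20) => t.
case: eqP => [_ _|/eqP tz]; first by rewrite subrr modulus0.
have tz0 : t - z != 0 by rewrite subr_eq0.
have -> : g t - g z - k * (t - z) = ((g t - g z) / (t - z) - k) * (t - z).
  by rewrite mulrBl divfK.
rewrite modulusM ler_pM2r ?modulus_gt0//; move/le_lt_trans; apply.
by rewrite ltr_pdivrMr// ltr_pMr// ltr1n.
Qed.

Lemma cderiv_cvg (g : CC R -> CC R) (z k : CC R) : cderiv g z k -> g t @[t --> z] --> g z.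
Proof.
move=> /cderivP/(_ 1 ltr01) gk; apply/(@cvg_modulusP _ _ (nbhs (z : CC R))) => e e0.
have M0 : 0 < modulus k + 1 by rewrite ltr_wpDl// modulus_ge0.
have near_z : \forall t \near z, modulus (t - z) < e / (modulus k + 1).
  by apply/nbhs_modulusP; exists (e / (modulus k + 1)) => //; rewrite divr_gt0.
apply: filterS2 gk near_z => t gt; rewrite ltr_pdivlMr// => te; apply: le_lt_trans te.
rewrite mulrDr mulr1 -[g t - g z](subrK (k * (t - z))).
apply: le_trans (modulusD _ _) _; rewrite modulusM.
by move: gt; rewrite mul1r; lra.
Qed.

Variables (U V : R -> R -> R) (h : CC R -> CC R).

(** With [U x] a primitive of the real part of [h] on the vertical line at [x], and [V y] one of the
    imaginary part on the horizontal line at [y], this is the imaginary part of the integral of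
    [h dz] around the rectangle. *)
Definition flux a b c d :=
  (U b d - U b c - (U a d - U a c)) - (V d b - V d a - (V c b - V c a)).

(* The integral over the boundary of a cell [[a, b] x [c, d]] of a field with
   [u_x = v_y] is of second order in the size of the cell. *)
Lemma flux_bound (a b c d p q : R) (k : CC R) (e : R) : a <= p <= b -> c <= q <= d -> 0 <= e ->
  (forall x t, a <= x <= b -> c <= t <= d ->
     is_derive t (1 : R) (U x) (complex.Re (h (x +i* t)))) ->
  (forall y t, c <= y <= d -> a <= t <= b ->
     is_derive t (1 : R) (V y) (complex.Im (h (t +i* y)))) ->
  (forall x y, a <= x <= b -> c <= y <= d ->
     modulus (h (x +i* y) - h (p +i* q) - k * ((x +i* y) - (p +i* q)))
       <= e * modulus ((x +i* y) - (p +i* q))) ->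
  `|flux a b c d| <= 2 * e * (b - a + (d - c)) ^+ 2.
Proof.
move=> /andP[ap pb] /andP[cq qd] e0 dU dV hk.
pose s := b - a + (d - c).
have ab := le_trans ap pb; have cd := le_trans cq qd.
have aa : a <= a <= b by rewrite lexx.
have bb : a <= b <= b by rewrite lexx andbT.
have cc : c <= c <= d by rewrite lexx.
have dd : c <= d <= d by rewrite lexx andbT.
have hks x y : a <= x <= b -> c <= y <= d ->
    modulus (h (x +i* y) - h (p +i* q) - k * ((x +i* y) - (p +i* q))) <= e * s.
  move=> xab ycd; apply: le_trans (hk _ _ xab ycd) _; apply: ler_wpM2l => //.
  have -> : (x +i* y) - (p +i* q) = (x - p) +i* (y - q) :> R[i] by [].
  apply: le_trans (modulus_Re_Im _ _) _.
  by rewrite /s; apply: lerD; rewrite ler_norml; apply/andP; split; lra.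
have hks2 x1 y1 x2 y2 : a <= x1 <= b -> c <= y1 <= d -> a <= x2 <= b -> c <= y2 <= d ->
    modulus (h (x2 +i* y2) - h (x1 +i* y1) - k * ((x2 +i* y2) - (x1 +i* y1))) <= 2 * (e * s).
  move=> X1 Y1 X2 Y2.
  have -> : h (x2 +i* y2) - h (x1 +i* y1) - k * ((x2 +i* y2) - (x1 +i* y1)) =
    (h (x2 +i* y2) - h (p +i* q) - k * ((x2 +i* y2) - (p +i* q))) -
    (h (x1 +i* y1) - h (p +i* q) - k * ((x1 +i* y1) - (p +i* q))) by ring.
  apply: le_trans (modulusD _ _) _; rewrite modulusN mulr_natl mulr2n.
  by apply: lerD; exact: hks.
(* Each pair of opposite sides contributes the real part of [k] times the area, up to an error;
   these main terms cancel in the flux. *)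
have UB : `|(U b d - U a d) - (U b c - U a c) - (complex.Re k * (b - a)) * (d - c)|
    <= 2 * (e * s) * (d - c).
  apply: (@derive_bound (fun t => U b t - U a t)
    (fun t => complex.Re (h (b +i* t)) - complex.Re (h (a +i* t)))) => // t tcd.
    by apply: is_deriveB; exact: dU.
  apply: le_trans (hks2 a t b t aa tcd bb tcd); apply: le_trans (Re_le_modulus _).
  rewrite le_eqVlt; apply/orP; left; apply/eqP; congr (`|_|).
  have -> : (b +i* t) - (a +i* t) = (b - a)%:C :> R[i].
    by apply/eqP; rewrite eq_complex /= subrr !eqxx.
  by case: (h _) => ? ?; case: (h _) => ? ?; case: k {hk hks hks2} => ? ? /=; ring.
have VB : `|(V d b - V c b) - (V d a - V c a) - (complex.Re k * (d - c)) * (b - a)|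
    <= 2 * (e * s) * (b - a).
  apply: (@derive_bound (fun t => V d t - V c t)
    (fun t => complex.Im (h (t +i* d)) - complex.Im (h (t +i* c)))) => // t tab.
    by apply: is_deriveB; exact: dV.
  apply: le_trans (hks2 t c t d tab cc tab dd); apply: le_trans (Im_le_modulus _).
  rewrite le_eqVlt; apply/orP; left; apply/eqP; congr (`|_|).
  have -> : (t +i* d) - (t +i* c) = 0 +i* (d - c) :> R[i].
    by apply/eqP; rewrite eq_complex /= subrr !eqxx.
  by case: (h _) => ? ?; case: (h _) => ? ?; case: k {hk hks hks2 UB} => ? ? /=; ring.
have -> : 2 * e * (b - a + (d - c)) ^+ 2 = 2 * (e * s) * (d - c) + 2 * (e * s) * (b - a).
  by rewrite /s; ring.
have -> : flux a b c d =
  ((U b d - U a d) - (U b c - U a c) - (complex.Re k * (b - a)) * (d - c)) -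
  ((V d b - V c b) - (V d a - V c a) - (complex.Re k * (d - c)) * (b - a)).
  by rewrite /flux; ring.
by apply: le_trans (ler_normB _ _) _; exact: lerD.
Qed.

Lemma nested_limit (s : nat -> R) (w : R) :
  (forall n, s n <= s n.+1 /\ s n.+1 + w / 2 ^+ n.+1 <= s n + w / 2 ^+ n) ->
  0 <= w -> exists p, forall n, s n <= p <= s n + w / 2 ^+ n.
Proof.
move=> sw w0.
have s_mono m n : (m <= n)%N -> s m <= s n /\ s n + w / 2 ^+ n <= s m + w / 2 ^+ m.
  elim: n => [|n IH]; first by rewrite leqn0 => /eqP ->.
  rewrite leq_eqVlt => /orP[/eqP ->//|/IH[h1 h2]].
  have [h3 h4] := sw n; split; first exact: le_trans h3.
  exact: le_trans h2.
have w2 n : 0 <= w / 2 ^+ n by rewrite divr_ge0// exprn_ge0.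
have ub n m : s m <= s n + w / 2 ^+ n.
  have [/s_mono[H _]|/ltnW/s_mono[_ H]] := leqP m n.
    by apply: le_trans H _; rewrite lerDl.
  by apply: le_trans H; rewrite lerDl.
exists (sup (range s)) => n; apply/andP; split.
  apply: ub_le_sup; last by exists n.
  by exists (s 0%N + w / 2 ^+ 0) => _ [m _ <-].
by apply: sup_le_ub; [exists (s 0%N), 0%N|move=> _ [m _ <-]].
Qed.

Lemma halving_small (w d : R) : 0 <= w -> 0 < d -> exists n, w / 2 ^+ n < d.
Proof.
move=> w0 d0; exists (Num.bound (w / d)).
rewrite ltr_pdivrMr ?exprn_gt0// mulrC -ltr_pdivrMr//.
apply: lt_trans (archi_boundP _) _; first by rewrite divr_ge0// ltW.
by rewrite -natrX ltr_nat ltn_expl.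
Qed.

(** Goursat's subdivision: a rectangle whose flux exceeds [e] times its squared size has a quarter
    with the same property. At the limit point of the nested quarters, differentiability with error
    [e / 2] contradicts this by [flux_bound]. *)
Lemma flux_zero (a b c d : R) : a < b -> c < d ->
  (forall x t, a <= x <= b -> c <= t <= d ->
     is_derive t (1 : R) (U x) (complex.Re (h (x +i* t)))) ->
  (forall y t, c <= y <= d -> a <= t <= b ->
     is_derive t (1 : R) (V y) (complex.Im (h (t +i* y)))) ->
  (forall x y, a <= x <= b -> c <= y <= d -> exists k, cderiv h (x +i* y) k) ->
  flux a b c d = 0.
Proof.
move=> ab cd dU dV dh.
pose w := b - a; pose l := d - c.
have w0 : 0 < w by rewrite subr_gt0.
have l0 : 0 < l by rewrite subr_gt0.
apply/eqP; apply: contrapT => /negP J0.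
(* Chosen so that the initial flux is twice the threshold in [bad]. *)
pose e := `|flux a b c d| / (2 * (w + l) ^+ 2).
have wl0 : 0 < (w + l) ^+ 2 by rewrite exprn_gt0// addr_gt0.
have e0 : 0 < e by rewrite divr_gt0 ?normr_gt0// mulr_gt0.
pose bad n (p : R * R) := [/\ a <= p.1, p.1 + w / 2 ^+ n <= b, c <= p.2,
  p.2 + l / 2 ^+ n <= d &
  e * ((w + l) / 2 ^+ n) ^+ 2 <
    `|flux p.1 (p.1 + w / 2 ^+ n) p.2 (p.2 + l / 2 ^+ n)|].
have bad0 : bad 0%N (a, c).
  rewrite /bad /= expr0 !divr1 /w /l; have -> : a + (b - a) = b by ring.
  have -> : c + (d - c) = d by ring.
  split => //; rewrite -/w -/l.
  have -> : e * (w + l) ^+ 2 = `|flux a b c d| / 2.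
    by rewrite /e; field; rewrite gt_eqF// addr_gt0.
  by rewrite ltr_pdivrMr// ltr_pMr ?normr_gt0// ltr1n.
(* The fluxes of the quarters add up to the whole one, while the threshold is divided by 4. *)
have badS n p : exists q, bad n p -> bad n.+1 q /\
    [/\ p.1 <= q.1, q.1 + w / 2 ^+ n.+1 <= p.1 + w / 2 ^+ n,
     p.2 <= q.2 & q.2 + l / 2 ^+ n.+1 <= p.2 + l / 2 ^+ n].
  have [badp|nb] := pselect (bad n p); last by exists p.
  pose w' := w / 2 ^+ n.+1; pose l' := l / 2 ^+ n.+1.
  have p20 : 0 < 2 ^+ n :> R by rewrite exprn_gt0.
  have wE : w / 2 ^+ n = w' + w' by rewrite /w' exprS; field; rewrite gt_eqF.
  have lE : l / 2 ^+ n = l' + l' by rewrite /l' exprS; field; rewrite gt_eqF.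
  have sE : ((w + l) / 2 ^+ n) ^+ 2 = 4 * ((w + l) / 2 ^+ n.+1) ^+ 2.
    by rewrite (exprS 2 n); field; rewrite gt_eqF.
  have w'0 : 0 < w' by rewrite divr_gt0// exprn_gt0.
  have l'0 : 0 < l' by rewrite divr_gt0// exprn_gt0.
  case: p badp => x y [/= ax xb cy yd Jbig].
  rewrite wE in xb; rewrite lE in yd; rewrite wE lE sE in Jbig.
  have {}Jbig : 4 * (e * ((w + l) / 2 ^+ n.+1) ^+ 2) < `|flux x (x + (w' + w')) y (y + (l' + l'))|.
    by apply: le_lt_trans Jbig; rewrite mulrCA.
  set S := e * _ in Jbig.
  have JE : flux x (x + (w' + w')) y (y + (l' + l')) =
      flux x (x + w') y (y + l') + flux (x + w') (x + w' + w') y (y + l') +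
      flux x (x + w') (y + l') (y + l' + l') +
      flux (x + w') (x + w' + w') (y + l') (y + l' + l').
    by rewrite /flux !addrA; ring.
  have quarter x' y' : (x' = x \/ x' = x + w') -> (y' = y \/ y' = y + l') ->
      S < `|flux x' (x' + w') y' (y' + l')| ->
      exists q : R * R, bad n (x, y) -> bad n.+1 q /\
        [/\ x <= q.1, q.1 + w / 2 ^+ n.+1 <= x + w / 2 ^+ n,
         y <= q.2 & q.2 + l / 2 ^+ n.+1 <= y + l / 2 ^+ n].
    move=> X Y H; exists (x', y') => _; rewrite wE lE /bad /= -/w' -/l' -/S; split.
      by case: X Y H => -> [] -> H; split => //; lra.
    by case: X Y {H} => -> [] ->; split; lra.
  have [H|H1] := ltP S `|flux x (x + w') y (y + l')|.
    by apply: quarter H; left.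
  have [H|H2] := ltP S `|flux (x + w') (x + w' + w') y (y + l')|.
    by apply: quarter H; [right|left].
  have [H|H3] := ltP S `|flux x (x + w') (y + l') (y + l' + l')|.
    by apply: quarter H; [left|right].
  have [H|H4] := ltP S `|flux (x + w') (x + w' + w') (y + l') (y + l' + l')|.
    by apply: quarter H; [right|right].
  exfalso; move: Jbig; rewrite JE ltNge => /negP; apply.
  apply: le_trans (ler_normD _ _) _.
  have := ler_normD (flux x (x + w') y (y + l') + flux (x + w') (x + w' + w') y (y + l'))
    (flux x (x + w') (y + l') (y + l' + l')).
  have := ler_normD (flux x (x + w') y (y + l')) (flux (x + w') (x + w' + w') y (y + l')).
  by lra.
have /choice[f fP] : forall n, exists f : R * R -> R * R, forall p, bad n p ->
    bad n.+1 (f p) /\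
    [/\ p.1 <= (f p).1, (f p).1 + w / 2 ^+ n.+1 <= p.1 + w / 2 ^+ n,
     p.2 <= (f p).2 & (f p).2 + l / 2 ^+ n.+1 <= p.2 + l / 2 ^+ n].
  by move=> n; have /choice[f fP] := badS n; exists f.
pose s := fix s n := if n is m.+1 then f m (s m) else (a, c).
have sbad n : bad n (s n) by elim: n => [//|n IH] /=; have [] := fP n _ IH.
have [|p pP] := @nested_limit (fst \o s) w _ (ltW w0).
  by move=> n /=; have [_ []] := fP n _ (sbad n).
have [|q qP] := @nested_limit (snd \o s) l _ (ltW l0).
  by move=> n /=; have [_ []] := fP n _ (sbad n).
have pab : a <= p <= b.
  by have := pP 0%N; rewrite /= expr0 divr1 /w; lra.
have qcd : c <= q <= d.
  by have := qP 0%N; rewrite /= expr0 divr1 /l; lra.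
have [k /cderivP hk] := dh p q pab qcd.
have e20 : 0 < e / 2 by rewrite divr_gt0.
have /nbhs_modulusP[r r0 hr] := hk _ e20.
have [n nr] := @halving_small (w + l) r (ltW (addr_gt0 w0 l0)) r0.
have [ax xb cy yd Jbig] := sbad n.
have {}pP := pP n; have {}qP := qP n; rewrite /= in pP qP.
set x := (s n).1 in ax xb Jbig pP; set y := (s n).2 in cy yd Jbig qP.
suff : `|flux x (x + w / 2 ^+ n) y (y + l / 2 ^+ n)| <= e * ((w + l) / 2 ^+ n) ^+ 2.
  by rewrite leNgt Jbig.
have -> : e = 2 * (e / 2) by field.
have <- : x + w / 2 ^+ n - x + (y + l / 2 ^+ n - y) = (w + l) / 2 ^+ n by ring.
apply: (@flux_bound _ _ _ _ p q k) => //; first exact: ltW.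
- by move=> u t ? ?; apply: dU; lra.
- by move=> u t ? ?; apply: dV; lra.
- move=> u v Hu Hv; apply: hr; apply: le_lt_trans nr.
  have -> : (u +i* v) - (p +i* q) = (u - p) +i* (v - q) :> R[i] by [].
  apply: le_trans (modulus_Re_Im _ _) _; rewrite mulrDl.
  by apply: lerD; rewrite ler_norml; apply/andP; split; lra.
Qed.

End Flux.

(** * Complex derivatives, the exponential, and functions constant off a finite set *)

Section MeanValue.
Variable R : realType.
Local Open Scope complex_scope.

Lemma cvg_mulC (f g : CC R -> CC R) (z a b : CC R) :
  f t @[t --> z] --> a -> g t @[t --> z] --> b -> f t * g t @[t --> z] --> a * b.
Proof. by move=> fa gb; exact: (@cvgM R[i] _ (nbhs (z : CC R)) _ f g a b fa gb). Qed.

Lemma cderiv_near (f g : CC R -> CC R) (z k : CC R) :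
  (\forall t \near z, f t = g t) -> cderiv f z k -> cderiv g z k.
Proof.
move=> fg /cderivP fk; apply/cderivP => e e0.
have fgz := nbhs_singleton fg.
by apply: filterS2 fg (fk e e0) => t <-; rewrite -fgz.
Qed.

Lemma cderiv_comp (f g : CC R -> CC R) (z k l : CC R) :
  cderiv f z k -> cderiv g (f z) l -> cderiv (g \o f) z (l * k).
Proof.
move=> fk [psi psil gE]; have cf := cderiv_cvg fk; have [phi phik fE] := fk.
exists (fun t => psi (f t) * phi t).
  apply: cvg_mulC phik.
  by move=> A nA; exact: (cf _ (psil _ nA)).
have gfE : \forall t \near z, g (f t) - g (f z) = psi (f t) * (f t - f z).
  exact: (cf _ gE).
by apply: filterS2 fE gfE => t /= E ->; rewrite E mulrA.
Qed.

Lemma cderiv_affine (f : CC R -> CC R) (z k a b : CC R) :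
  cderiv f z k -> cderiv (fun t => a + b * f t) z (b * k).
Proof.
move=> [phi phik fE]; exists (fun t => b * phi t).
  apply: cvg_mulC phik; apply/(@cvg_modulusP _ _ (nbhs (z : CC R))) => e e0.
  by apply/nbhs_modulusP; exists 1 => // t _; rewrite subrr modulus0.
apply: filterS fE => t E.
have -> : a + b * f t - (a + b * f z) = b * (f t - f z) by ring.
by rewrite E mulrA.
Qed.

Definition cexp (w : CC R) : CC R :=
  (expR (complex.Re w) * cos (complex.Im w)) +i* (expR (complex.Re w) * sin (complex.Im w)).

Lemma cexpD (v w : CC R) : cexp (v + w) = cexp v * cexp w :> R[i].
Proof.
case: v w => [a b] [c d]; rewrite /cexp /= expRD cosD sinD.
by apply/eqP; rewrite eq_complex /=; apply/andP; split; apply/eqP; ring.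
Qed.

Lemma modulus_cexp (w : CC R) : modulus (cexp w) = expR (complex.Re w).
Proof.
rewrite /modulus normc_def /= !exprMn -mulrDr cos2Dsin2 mulr1.
by rewrite sqrtr_sqr ger0_norm// expR_ge0.
Qed.

Lemma is_derive_near0 (f : R -> R) (k : R) : is_derive (0 : R) (1 : R) f k ->
  forall e, 0 < e -> exists2 d, 0 < d & forall t, `|t| < d ->
    `|f t - f 0 - k * t| <= e * `|t|.
Proof.
move=> fk e e0.
have [df dfk] := fk.
have H : h^-1 *: ((f \o shift 0) (h *: 1) - f 0) @[h --> 0^'] --> k.
  by rewrite -dfk; exact: df.
have /cvgrPdist_le/(_ e e0) := H.
rewrite near_withinE => /nbhs_ballP[d /= d0 fd]; exists d => // t td.
have [->|t0] := eqVneq t 0; first by rewrite mulr0 !subrr !normr0 mulr0.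
have := fd t; rewrite /ball /= sub0r normrN => /(_ td t0).
rewrite addr0 /GRing.scale /= mulr1 => ft.
have -> : f t - f 0 - k * t = (t^-1 * (f t - f 0) - k) * t by field.
by rewrite normrM ler_pM2r ?normr_gt0// distrC.
Qed.

(** The functional equation [cexpD] reduces the claim to first-order estimates of [expR], [cos] and
    [sin] at [0]. *)
Lemma cderiv_cexp (w : CC R) : cderiv cexp w (cexp w).
Proof.
apply/cderivP => e e0.
(* The [8] is the sum [1 + 2 + 4 + 1] of the constants in [h1] to [h4] below. *)
have e1 : 0 < e / (8 * expR (complex.Re w)) by rewrite divr_gt0// mulr_gt0// expR_gt0.
set E := e / _ in e1.
pose e2 := Num.min E 1.
have e20 : 0 < e2 by rewrite lt_min e1 ltr01.
have e2E : e2 <= E by rewrite ge_min lexx.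
have e21 : e2 <= 1 by rewrite ge_min lexx orbT.
clearbody e2.
have [d1 d10 exp_d] := is_derive_near0 (@is_derive_expR R 0) e20.
have [d2 d20 cos_d] := is_derive_near0 (@is_derive_cos R 0) e20.
have [d3 d30 sin_d] := is_derive_near0 (@is_derive_sin R 0) e20.
apply/nbhs_modulusP; exists (Num.min (Num.min d1 d2) (Num.min d3 e2)).
  by rewrite !lt_min d10 d20 d30 e20.
move=> t; rewrite !lt_min => /andP[/andP[t1 t2] /andP[t3 t4]].
have -> : cexp t = cexp w * cexp (t - w) :> R[i] by rewrite -cexpD addrC subrK.
have -> : cexp w * cexp (t - w) - cexp w - cexp w * (t - w) =
  cexp w * (cexp (t - w) - 1 - (t - w)) :> R[i] by ring.
rewrite modulusM modulus_cexp.
have := Re_le_modulus (t - w); have := Im_le_modulus (t - w).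
move: t1 t2 t3 t4; case: (t - w) => x y /=; set m := modulus _ => m1 m2 m3 m4 ym xm.
have := exp_d x (le_lt_trans xm m1); have := cos_d y (le_lt_trans ym m2).
have := sin_d y (le_lt_trans ym m3).
rewrite expR0 cos0 sin0 oppr0 !mul0r !mul1r ?oppr0 ?addr0 ?subr0 => sy cy ex.
have m0 : 0 <= m by apply: le_trans xm.
have x2 : `|x| <= e2 by apply: le_trans xm (ltW m4).
have exb : `|expR x - 1| <= 2 * m.
  rewrite -[expR x - 1](subrK x); apply: le_trans (ler_normD _ _) _.
  have : e2 * `|x| <= m by rewrite -[m]mul1r ler_pM// ltW.
  by lra.
have syb : `|sin y| <= 2 * e2.
  rewrite -[sin y](subrK y); apply: le_trans (ler_normD _ _) _.
  have y2 : `|y| <= e2 by apply: le_trans ym (ltW m4).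
  have : e2 * `|y| <= e2 by rewrite -[leRHS]mulr1 ler_pM2l//; lra.
  by lra.
have -> : (expR x * cos y +i* (expR x * sin y)) - 1 - (x +i* y) =
  (((expR x - 1 - x) * cos y + (1 + x) * (cos y - 1)) +i*
   ((expR x - 1) * sin y + (sin y - y))) :> R[i].
  by apply/eqP; rewrite eq_complex /=; apply/andP; split; apply/eqP; ring.
have bound : modulus (((expR x - 1 - x) * cos y + (1 + x) * (cos y - 1)) +i*
   ((expR x - 1) * sin y + (sin y - y)) : CC R) <= 8 * (e2 * m).
  apply: le_trans (modulus_Re_Im _ _) _.
  have h1 : `|(expR x - 1 - x) * cos y| <= e2 * m.
    rewrite normrM -[leRHS]mulr1 ler_pM//; last by rewrite ler_norml cos_geN1 cos_le1.
    by apply: le_trans ex _; rewrite ler_pM2l.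
  have h2 : `|(1 + x) * (cos y - 1)| <= 2 * (e2 * m).
    rewrite normrM; apply: ler_pM => //; last by apply: le_trans cy _; rewrite ler_pM2l.
    by apply: le_trans (ler_normD _ _) _; rewrite normr1; lra.
  have h3 : `|(expR x - 1) * sin y| <= 4 * (e2 * m).
    rewrite normrM; apply: (@le_trans _ _ ((2 * m) * (2 * e2))); last by lra.
    by rewrite ler_pM.
  have h4 : `|sin y - y| <= e2 * m by apply: le_trans sy _; rewrite ler_pM2l.
  have := ler_normD ((expR x - 1 - x) * cos y) ((1 + x) * (cos y - 1)).
  have := ler_normD ((expR x - 1) * sin y) (sin y - y).
  by lra.
apply: (@le_trans _ _ (expR (complex.Re w) * (8 * (e2 * m)))).
  by rewrite ler_pM2l// expR_gt0.
have -> : e = 8 * expR (complex.Re w) * E.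
  by rewrite /E mulrC divfK// gt_eqF// mulr_gt0// expR_gt0.
have -> : expR (complex.Re w) * (8 * (e2 * m)) = 8 * expR (complex.Re w) * e2 * m by ring.
by apply: ler_wpM2r => //; apply: ler_wpM2l => //; rewrite mulr_ge0 ?expR_ge0.
Qed.

(** Induction on [E]: an interval is cut at the exceptional point [e], and [I e] is the limit of the
    constant values on either side. *)
Lemma constant_off_seq (I : R -> R) (E : seq R) : continuous I ->
  (forall x1 x2, x1 < x2 -> (forall x, x1 <= x <= x2 -> x \notin E) -> I x1 = I x2) ->
  forall x1 x2, x1 < x2 -> I x1 = I x2.
Proof.
move=> cI; elim: E => [|e E IH] IE; first by move=> *; exact: IE.
apply: IH => x1 x2 x12 nE.
have [e12|ne12] := boolP (x1 <= e <= x2); last first.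
  apply: IE => // x x12'; rewrite inE negb_or nE// andbT.
  by apply: contra ne12 => /eqP <-.
have limE (c : R) : (forall d, 0 < d -> exists2 y, `|y - e| < d & I y = c) -> I e = c.
  move=> H; apply/eqP; rewrite -subr_eq0 -normr_eq0 eq_le normr_ge0 andbT.
  apply/ler_addgt0Pr => d d0; rewrite add0r.
  have /cvgrPdist_lt/(_ d d0)/nbhs_ballP[r /= r0 Ir] := cI e.
  have [y ye <-] := H r r0.
  by apply/ltW/Ir; rewrite /ball /= distrC.
move: e12 => /andP[x1e ex2].
have -> : I x1 = I e.
  have [->//|] := eqVneq x1 e; rewrite -subr_eq0 => ne.
  have {ne x1e} x1e : x1 < e by rewrite lt_neqAle x1e andbT -subr_eq0.
  (* This point is within [d] of [e] and strictly between [x1] and [e]. *)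
  apply/esym/limE => d d0; exists (Num.max (e - d / 2) ((x1 + e) / 2)).
    by rewrite distrC ger0_norm; case: (leP (e - d / 2)); lra.
  apply/esym/IE; first by rewrite lt_max; apply/orP; right; lra.
  move=> x; rewrite le_max => /andP[x1x xm]; rewrite inE negb_or.
  have xe : x < e by case/orP: xm; lra.
  by rewrite lt_eqF//= nE// x1x /=; lra.
have [->//|] := eqVneq e x2; rewrite -subr_eq0 => ne.
have {ne ex2} ex2 : e < x2 by rewrite lt_neqAle ex2 andbT -subr_eq0.
apply/limE => d d0; exists (Num.min (e + d / 2) ((x2 + e) / 2)).
  by rewrite ger0_norm; case: (leP (e + d / 2)); lra.
apply/IE; first by rewrite gt_min; apply/orP; right; lra.
move=> x; rewrite ge_min => /andP[xm x1x]; rewrite inE negb_or.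
have xe : e < x by case/orP: xm; lra.
by rewrite gt_eqF//= nE// x1x andbT; lra.
Qed.

End MeanValue.

(** * The mean value inequality on a disc *)

Section MeanValueBound.
Variable R : realType.
Local Open Scope complex_scope.

(* [E] lists the radii of circles on which [g] may fail to be differentiable. In
   the coordinates [z = a + cexp (x +i* t)] the mean [I x] of [g] over a circle is
   the flux of a field through a period, hence constant in [x] between
   exceptional radii, and by continuity everywhere. *)
Lemma mean_value_bound (g : CC R -> CC R) (a : CC R) (r M : R) (E : seq R) : 0 < r ->
  (forall z, modulus (z - a) <= r -> g t @[t --> z] --> g z) ->
  (forall z, modulus (z - a) < r -> modulus (z - a) \notin E -> exists k, cderiv g z k) ->
  (forall z, modulus (z - a) = r -> modulus (g z) <= M) ->
  modulus (g a) <= M.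
Proof.
move=> r0 gc gd gM.
pose S := ln r; have rS : expR S = r by rewrite lnK.
have modD (z : CC R) : a + z - a = z by rewrite addrC addKr.
have M0 : 0 <= M.
  apply: le_trans (modulus_ge0 _) (gM (a + cexp (S +i* 0)) _).
  by rewrite modD modulus_cexp /= rS.
have [ga0|ga0] := eqVneq (g a) 0; first by rewrite ga0 modulus0.
set m := modulus (g a); have m0 : 0 < m by exact: modulus_gt0.
(* A unimodular factor that makes the value at the centre the positive real [m], so that real parts
   suffice. *)
pose l : R[i] := m%:C / g a.
have l_ga : l * g a = m%:C by rewrite /l divfK.
have l1 (z : CC R) : modulus (l * z : CC R) = modulus z.
  rewrite modulusM /l modulusM modulusV -/m.
  suff -> : modulus (m%:C : CC R) = m by rewrite divff ?mul1r// gt_eqF.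
  by apply: complexI; rewrite modulusE ger0_norm// lecR ltW.
(* Clipping at [S] makes [H] continuous on the whole plane, although [g] is controlled only on the
   closed disc. *)
pose clip x := Num.min x S.
have clipS x : clip x <= S by rewrite ge_min lexx orbT.
have clipE x : x <= S -> clip x = x by move=> xS; rewrite /clip min_l.
have clip1 x y : `|clip x - clip y| <= `|x - y|.
  rewrite /clip; case: (leP x S) => xS; case: (leP y S) => yS.
  - by [].
  - by rewrite [leLHS]ler0_norm 1?[leRHS]ler0_norm; lra.
  - by rewrite [leLHS]ger0_norm 1?[leRHS]ger0_norm; lra.
  - by rewrite subrr normr0.
pose q (w : CC R) : CC R := clip (complex.Re w) +i* complex.Im w.
pose P (w : CC R) : CC R := a + cexp (q w).
pose H (w : CC R) : CC R := l * g (P w).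
have PE w : modulus (P w - a) = expR (clip (complex.Re w)) by rewrite modD modulus_cexp.
have Pr w : modulus (P w - a) <= r by rewrite PE -rS ler_expR.
have Hc w e : 0 < e -> \forall t \near w, modulus (H t - H w) < e.
  move=> e0.
  have cP : P t @[t --> w] --> P w.
    apply/(@cvg_modulusP _ _ (nbhs (w : CC R))) => d d0.
    have /cvg_modulusP/(_ d d0)/nbhs_modulusP[d1 d10 Hd1] := cderiv_cvg (cderiv_cexp (q w)).
    apply/nbhs_modulusP; exists (d1 / 2); first by rewrite divr_gt0.
    move=> t tw; rewrite /P opprD addrACA subrr add0r; apply: Hd1.
    have -> : q t - q w = (clip (complex.Re t) - clip (complex.Re w)) +i*
      (complex.Im t - complex.Im w) :> R[i] by [].
    apply: le_lt_trans (modulus_Re_Im _ _) _.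
    have := Re_le_modulus (t - w); have := Im_le_modulus (t - w).
    have := clip1 (complex.Re t) (complex.Re w).
    by move: tw; rewrite !raddfB /=; lra.
  have /cvg_modulusP/(_ e e0) gP := gc _ (Pr w).
  have {}gP : \forall t \near w, modulus (g (P t) - g (P w)) < e by exact: (cP _ gP).
  by apply: filterS gP => t; rewrite /H -mulrBr l1.
pose u x t := complex.Re (H (x +i* t)).
have uc x t e : 0 < e -> exists2 d, 0 < d & forall x' t', `|x' - x| < d -> `|t' - t| < d ->
    modulus (H (x' +i* t') - H (x +i* t)) < e.
  move=> /(Hc (x +i* t))/nbhs_modulusP[d d0 Hd].
  exists (d / 2); first by rewrite divr_gt0.
  move=> x' t' xx tt; apply: Hd.
  have -> : (x' +i* t') - (x +i* t) = (x' - x) +i* (t' - t) :> R[i] by [].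
  by apply: le_lt_trans (modulus_Re_Im _ _) _; lra.
have u_cont x : continuous (u x).
  move=> t; apply/cvgrPdist_lt => e e0; have [d d0 Hd] := uc x t e e0.
  apply/nbhs_ballP; exists d => // t'; rewrite /ball /= distrC => tt.
  rewrite distrC /u -raddfB; apply: le_lt_trans (Re_le_modulus _) _.
  by apply: Hd; rewrite // subrr normr0.
have v_cont y : continuous (fun t => complex.Im (H (t +i* y))).
  move=> t; apply/cvgrPdist_lt => e e0; have [d d0 Hd] := uc t y e e0.
  apply/nbhs_ballP; exists d => // t'; rewrite /ball /= distrC => tt.
  rewrite distrC -raddfB; apply: le_lt_trans (Im_le_modulus _) _.
  by apply: Hd; rewrite // subrr normr0.
(* Primitives are chosen as a function of the integrand, so that equal integrands have equal
   primitives. *)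
have /choice[prim primP] : forall K : R, exists F : (R -> R) -> R -> R,
    forall f : R -> R, continuous f -> forall x : R, K < x -> is_derive x (1 : R) (F f) (f x).
  move=> K; suff /choice[F FP] : forall f : R -> R, exists F : R -> R,
    continuous f -> forall x : R, K < x -> is_derive x (1 : R) F (f x) by exists F.
  move=> f.
  have [cf|ncf] := pselect (continuous f); last by exists f.
  by have [F FP] := primitive K cf; exists F.
pose W x := prim (- 1) (u x).
have dW (x t : R) : 0 <= t -> is_derive t (1 : R) (W x) (u x t).
  by move=> t0; apply: primP => //; apply: lt_le_trans t0; rewrite ltrN10.
pose tau : R := pi *+ 2; have tau0 : 0 < tau by rewrite mulrn_wgt0// pi_gt0.
pose I x := W x tau - W x 0.
have I_bound x k e : (forall t, `|u x t - k| <= e) -> `|I x - k * tau| <= e * tau.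
  move=> ue; rewrite -[tau]subr0; apply: derive_bound (ltW tau0) _ _.
    by move=> t /andP[t0 _]; exact: dW.
  by move=> t _; exact: ue.
have I_cont : continuous I.
  move=> x; apply/cvgrPdist_lt => e e0.
  have e20 : 0 < e / tau / 2 by rewrite divr_gt0// divr_gt0.
  have : \forall y \near x, `[0, tau] `<=` (fun t => `|u x t - u y t| < e / tau).
    have /compact_near_coveringP cover := @segment_compact R 0 tau.
    apply: (cover _ (nbhs x) (fun y t => `|u x t - u y t| < e / tau)) => t _.
    have [d d0 Hd] := uc x t _ e20.
    have near_t : \forall s \near t, `|s - t| < d.
      by apply/nbhs_ballP; exists d => // s; rewrite /ball /= distrC.
    have near_x : \forall y \near x, `|y - x| < d.
      by apply/nbhs_ballP; exists d => // s; rewrite /ball /= distrC.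
    near=> s y => /=.
    have st : `|s - t| < d by near: s.
    have yx : `|y - x| < d by near: y.
    have h1 := Hd x s _ st; have h2 := Hd y s yx st.
    have {}h1 : modulus (H (x +i* s) - H (x +i* t)) < e / tau / 2.
      by apply: h1; rewrite subrr normr0.
    rewrite /u -raddfB; apply: le_lt_trans (Re_le_modulus _) _.
    apply: le_lt_trans (modulus_triangle (H (x +i* t)) _ _) _.
    by rewrite (modulusBC (H (x +i* t)) (H (y +i* s))); lra.
  apply: filterS => y uy.
  suff : `|(W x tau - W y tau) - (W x 0 - W y 0) - 0 * (tau - 0)| < e.
    by rewrite mul0r subr0 /I; congr (`|_| < e); ring.
  have [t0 t0I t0max] : exists2 t0, t0 \in `[0, tau] &
      forall t, t \in `[0, tau] -> `|u x t - u y t| <= `|u x t0 - u y t0|.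
    have := @EVT_max R (fun t => `|u x t - u y t|) 0 tau (ltW tau0).
    apply; apply: continuous_subspaceT => t.
    by apply: cvg_norm; apply: cvgB; exact: u_cont.
  have := @derive_bound R (fun t => W x t - W y t) (fun t => u x t - u y t) 0 tau 0
    `|u x t0 - u y t0| (ltW tau0).
  move=> db; apply: (@le_lt_trans _ _ (`|u x t0 - u y t0| * (tau - 0))).
    apply: db => t t0tau; last by rewrite subr0; exact: t0max.
    by apply: is_deriveB; apply: dW; case/andP: t0tau.
  by rewrite subr0 -ltr_pdivlMr//; exact: uy.
have I_const : forall x1 x2 : R, x1 < x2 -> I x1 = I x2.
  (* [S] is added because of the kink of [clip]; to its right [u x] does not depend on [x]. *)
  apply: (@constant_off_seq R I (S :: map (@ln R) E)) => // x1 x2 x12 nE.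
  have [x2S|Sx2] := ltP x2 S; last first.
    have Sx1 : S <= x1.
      rewrite leNgt; apply/negP => x1S.
      by have := nE S; rewrite inE eqxx (ltW x1S) Sx2 => /(_ isT).
    rewrite /I /W (_ : u x1 = u x2)//; apply/funext => t.
    by rewrite /u /H /P /q /clip /= !min_r.
  pose V y := prim (x1 - 1) (fun t => complex.Im (H (t +i* y))).
  (* By periodicity of [cexp] the horizontal sides cancel, so the vanishing flux says
     [I x1 = I x2]. *)
  have V_tau : V tau = V 0.
    rewrite /V; congr (prim _ _); apply/funext => t.
    by rewrite /H /P /q /cexp /= /tau cos2pi sin2pi cos0 sin0.
  have : flux W V x1 x2 0 tau = 0.
    apply: (@flux_zero R W V H) => //.
    - by move=> x t _ /andP[t0 _]; exact: dW.
    - by move=> y t _ /andP[t0 _]; apply: primP => //; lra.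
    - move=> x y xx _.
      have xS : x < S by case/andP: xx => _ /le_lt_trans; apply.
      have Hnear : \forall t \near (x +i* y : CC R), 0 + l * g (a + 1 * cexp t) = H t.
        apply/nbhs_modulusP; exists (S - x); first by rewrite subr_gt0.
        move=> t /(le_lt_trans (Re_le_modulus _)); rewrite raddfB /= => tx.
        have tS : complex.Re t <= S by move: tx; rewrite ltr_norml; lra.
        rewrite add0r mul1r /H /P /q clipE//; congr (_ * g (_ + cexp _)).
      have [k gk] : exists k, cderiv g (a + 1 * cexp (x +i* y)) k.
        apply: gd; rewrite mul1r modD modulus_cexp /=; first by rewrite -rS ltr_expR.
        apply/negP => xE; have := nE x xx; rewrite inE negb_or => /andP[_ /negP]; apply.
        by rewrite -[x]expRK; apply: map_f.
      exists (l * (k * (1 * cexp (x +i* y)))); apply: cderiv_near Hnear _.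
      apply: (@cderiv_affine R (fun t => g (a + 1 * cexp t))).
      by apply: (@cderiv_comp R (fun t => a + 1 * cexp t) g) gk; exact/cderiv_affine/cderiv_cexp.
  by rewrite /flux V_tau /I; lra.
apply/ler_addgt0Pr => e e0.
have /cvg_modulusP/(_ e e0)/nbhs_modulusP[d d0 gd'] : g t @[t --> a] --> g a.
  by apply: gc; rewrite subrr modulus0 ltW.
(* On the circle of radius [expR x < d], [g] is within [e] of [g a]; its mean is compared with the
   one at radius [r], which [M] bounds. *)
pose x := Num.min S (ln d) - 1.
have xS : x < S by rewrite /x; case: (leP S (ln d)); lra.
have xd : expR x < d by rewrite -[d]lnK// ltr_expR /x; case: (leP S (ln d)); lra.
have h1 : `|I x - m * tau| <= e * tau.
  apply: I_bound => t.
  have -> : u x t - m = complex.Re (H (x +i* t) - l * g a) by rewrite raddfB l_ga.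
  apply: le_trans (Re_le_modulus _) _; rewrite /H -mulrBr l1; apply/ltW/gd'.
  by rewrite PE /= clipE// ltW.
have h2 : `|I S - 0 * tau| <= M * tau.
  apply: I_bound => t; rewrite subr0; apply: le_trans (Re_le_modulus _) _.
  by rewrite /H l1; apply: gM; rewrite PE /= clipE.
rewrite -(ler_pM2r tau0) mulrDl.
move: h1 h2; rewrite (I_const _ _ xS) mul0r subr0 distrC => h1 h2.
have := ler_norm (m * tau - I S); have := ler_norm (I S).
by lra.
Unshelve. all: by end_near. Qed.

End MeanValueBound.

(** * Zeros of families of entire functions *)

Section Zeros.
Variable R : realType.
Implicit Types (f g : CC R -> CC R) (z : CC R).

Lemma cvg_addC f g z (a b : CC R) :
  f t @[t --> z] --> a -> g t @[t --> z] --> b -> f t + g t @[t --> z] --> a + b.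
Proof. by move=> fa gb; exact: (@cvgD R[i] (CC R) _ (nbhs z) _ f g a b fa gb). Qed.

Lemma cvg_cstC z (a : CC R) : (fun=> a) @ z --> a.
Proof.
apply/(@cvg_modulusP _ _ (nbhs z)) => e e0.
by apply/nbhs_modulusP; exists 1 => // t _; rewrite subrr modulus0.
Qed.

Lemma cvg_invC f z (a : R[i]) : a != 0 ->
  f t @[t --> z] --> (a : CC R) -> (fun t => (f t : R[i])^-1) @ z --> (a^-1 : CC R).
Proof. by move=> a0 fa; exact: (@cvgV R[i] _ (nbhs z) _ f a a0 fa). Qed.

Lemma cderivM f g z (k l : CC R) : cderiv f z k -> cderiv g z l ->
  cderiv (fun t => f t * g t) z (k * g z + f z * l).
Proof.
move=> fk gl; have cg := cderiv_cvg gl.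
have [phi phik fE] := fk; have [psi psil gE] := gl.
exists (fun t => phi t * g t + f z * psi t).
  apply: cvg_addC; first exact: cvg_mulC phik cg.
  exact: (@cvg_mulC R (fun=> f z) psi z _ _ (@cvg_cstC z (f z)) psil).
apply: filterS2 fE gE => t Ef Eg.
have -> : f t * g t - f z * g z = (f t - f z) * g t + f z * (g t - g z) by ring.
by rewrite Ef Eg; ring.
Qed.

Lemma near_neq0 f z : f t @[t --> z] --> f z -> f z != 0 -> \forall t \near z, f t != 0.
Proof.
move=> /cvg_modulusP cf fz; have := cf _ (modulus_gt0 fz).
apply: filterS => t; apply: contraTneq => ->.
by rewrite sub0r modulusN ltxx.
Qed.

Lemma cderivV f z (k : CC R) : f z != 0 -> cderiv f z k ->
  exists l, cderiv (fun t => (f t : R[i])^-1) z l.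
Proof.
move=> fz fk; have cf := cderiv_cvg fk; have [phi phik fE] := fk.
exists (- (k * ((f z)^-1 * (f z)^-1)) : R[i]).
exists (fun t => - (f z : R[i])^-1 * (phi t * (f t)^-1)).
  have -> : - (k * ((f z)^-1 * (f z)^-1)) = - (f z)^-1 * (k * (f z)^-1) :> R[i] by ring.
  have fV := @cvg_mulC R phi (fun t => (f t : R[i])^-1) z _ _ phik (cvg_invC fz cf).
  exact: (@cvg_mulC R (fun=> - (f z : R[i])^-1) _ z _ _ (@cvg_cstC z _) fV).
apply: filterS2 fE (near_neq0 cf fz) => t Ef ft.
have -> : (f t)^-1 - (f z)^-1 = - (f z)^-1 * ((f t - f z) * (f t)^-1) :> R[i].
  by field; rewrite ft fz.
by rewrite Ef; ring.
Qed.

Lemma cderiv_sub z (c : CC R) : cderiv (fun t => t - c) z 1.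
Proof.
apply/cderivP => e e0; apply/nbhs_modulusP; exists 1 => // t _.
have -> : t - c - (z - c) - 1 * (t - z) = 0 by ring.
by rewrite modulus0 mulr_ge0 ?modulus_ge0// ltW.
Qed.

(* Dividing [g] by [z - zeta] for a zero [zeta] with [|zeta - p| <= rho] gains a
   factor 3 between the centre and the circle of radius [4 * rho]; the quotient
   is only known to be continuous at [zeta], whence the exceptional set [E]. *)
Lemma zeros_bound_off_seq (p : CC R) (rho : R) (s : seq (CC R)) : 0 < rho -> uniq s ->
  (forall zeta, zeta \in s -> modulus (zeta - p) <= rho) ->
  forall g (E : seq (CC R)) M, (forall z, g t @[t --> z] --> g z) ->
  (forall z, z \notin E -> exists k, cderiv g z k) ->
  (forall zeta, zeta \in s -> zeta \notin E /\ g zeta = 0) ->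
  (forall z, modulus (z - p) = 4 * rho -> modulus (g z) <= M) ->
  modulus (g p) * 3 ^+ size s <= M.
Proof.
move=> rho0; elim: s => [|zeta s IH] us sp g E M cg dg sE gM.
  rewrite expr0 mulr1.
  apply: (@mean_value_bound R g p (4 * rho) M [seq modulus (e - p) | e <- E]) => //.
    by rewrite mulr_gt0.
  move=> z _ nE; apply: dg; apply: contra nE => zE.
  by apply/mapP; exists z.
have [zetaE gz0] := sE zeta (mem_head _ _).
have [k gk] := dg zeta zetaE.
have zp : modulus (zeta - p) <= rho by apply: sp; exact: mem_head.
(* The derivative as value at [zeta] makes the quotient continuous there. *)
pose g1 (z : R[i]) : R[i] := if z == zeta then k else g z * (z - zeta)^-1.
have gE (z : R[i]) : g z = g1 z * (z - zeta).
  rewrite /g1; case: eqP => [->|/eqP zz]; first by rewrite subrr mulr0.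
  by rewrite mulfVK// subr_eq0.
have g1E z : z != zeta -> \forall t \near z, (g t : R[i]) * (t - zeta)^-1 = g1 t.
  move=> zz; have z0 : (fun t : CC R => t - zeta) z != 0 by rewrite subr_eq0.
  have := near_neq0 (cderiv_cvg (cderiv_sub z zeta)) z0.
  by apply: filterS => t tz; rewrite /g1 -subr_eq0 (negbTE tz).
have g1v z : z != zeta -> g1 z = g z * (z - zeta)^-1 by rewrite /g1 => /negbTE ->.
have dsub z : z != zeta -> exists l, cderiv (fun t => (t - zeta : R[i])^-1) z l.
  by move=> zz; apply: (cderivV _ (cderiv_sub z zeta)); rewrite subr_eq0.
have cg1 z : (g1 : CC R -> CC R) t @[t --> z] --> (g1 z : CC R).
  have [->|zz] := eqVneq z zeta.
    have [phi /cvg_modulusP phik phiE] := gk.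
    apply/(@cvg_modulusP _ _ (nbhs zeta)) => e e0.
    apply: filterS2 phiE (phik e e0) => t; rewrite gz0 subr0 /g1 eqxx.
    by case: eqP => [_ _ _|/eqP tz ->]; rewrite ?subrr ?modulus0// mulfK// subr_eq0.
  have [l dl] := dsub z zz.
  have H := cvg_mulC (cg z) (cderiv_cvg dl).
  rewrite g1v//; apply/(@cvg_modulusP _ _ (nbhs z)) => e e0.
  move/cvg_modulusP/(_ e e0) in H.
  by apply: filterS2 (g1E z zz) H => t <-.
have dg1 z : z \notin zeta :: E -> exists l, cderiv (g1 : CC R -> CC R) z l.
  rewrite inE negb_or => /andP[zz /dg[k1 gk1]].
  have [l dl] := dsub z zz.
  by exists (k1 * (z - zeta)^-1 + g z * l : R[i]); apply: cderiv_near (g1E z zz) (cderivM gk1 dl).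
have g1M z : modulus (z - p) = 4 * rho -> modulus (g1 z : CC R) <= M / (3 * rho).
  move=> zr; have := gM z zr; rewrite gE modulusM => gzM.
  have zz : 3 * rho <= modulus (z - zeta).
    by have := modulus_triangle zeta z p; lra.
  rewrite ler_pdivlMr ?mulr_gt0//; apply: le_trans gzM.
  by apply: ler_wpM2l => //; exact: modulus_ge0.
have := IH _ _ g1 (zeta :: E) (M / (3 * rho)) cg1 dg1 _ g1M.
move: us => /= /andP[zs us] IH'.
have : modulus (g1 p : CC R) * 3 ^+ size s <= M / (3 * rho).
  apply: IH' => // [x xs|x xs]; first by apply: sp; rewrite inE xs orbT.
  have [xE gx0] : x \notin E /\ g x = 0 by apply: sE; rewrite inE xs orbT.
  have xz : x != zeta by apply: contraNneq zs => <-.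
  by rewrite inE negb_or xz xE g1v// gx0 mul0r.
rewrite ler_pdivlMr ?mulr_gt0// => h; apply: le_trans h.
rewrite gE modulusM exprS (modulusBC p).
have -> : modulus (g1 p : CC R) * modulus (zeta - p) * (3 * 3 ^+ size s) =
  modulus (g1 p : CC R) * 3 ^+ size s * (3 * modulus (zeta - p)) by ring.
by rewrite ler_wpM2l// ?ler_pM2l// mulr_ge0 ?modulus_ge0 ?exprn_ge0.
Qed.

(** A Jensen-type count: a lower bound at [p] and an upper bound on the circle limit the number of
    zeros. *)
Lemma zeros_bound f (p : CC R) (rho M : R) (s : seq (CC R)) : 0 < rho ->
  (forall z, exists k, cderiv f z k) -> uniq s ->
  (forall zeta, zeta \in s -> f zeta = 0 /\ modulus (zeta - p) <= rho) ->
  (forall z, modulus (z - p) = 4 * rho -> modulus (f z) <= M) ->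
  modulus (f p) * 3 ^+ size s <= M.
Proof.
move=> rho0 df us sf fM; apply: (@zeros_bound_off_seq p rho s _ _ _ f [::]) => //.
- by move=> z /sf[].
- by move=> z; have [k /cderiv_cvg] := df z.
- by move=> z /sf[].
Qed.

(* Minimum modulus principle: [1 / f] obeys the mean value bound. *)
Lemma zero_in_disc f (c : CC R) (r a : R) : 0 < r ->
  (forall z, exists k, cderiv f z k) ->
  (forall z, modulus (z - c) = r -> a < modulus (f z)) -> modulus (f c) < a ->
  exists z, f z = 0 /\ modulus (z - c) < r.
Proof.
move=> r0 df fr fc; apply: contrapT => nz.
have a0 : 0 < a by apply: le_lt_trans fc; exact: modulus_ge0.
have fz z : modulus (z - c) <= r -> f z != 0.
  rewrite le_eqVlt => /orP[/eqP/fr zr|zr]; last by apply/eqP => z0; apply: nz; exists z.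
  by apply: contraTneq zr => ->; rewrite modulus0 -leNgt ltW.
have dV z : modulus (z - c) <= r -> exists k, cderiv (fun t => (f t : R[i])^-1) z k.
  by move=> /fz f0; have [k fk] := df z; exact: cderivV f0 fk.
have : modulus ((f c : R[i])^-1 : CC R) <= a^-1.
  apply: (@mean_value_bound R (fun t => (f t : R[i])^-1) c r a^-1 [::]) => //.
  - by move=> z /dV[k /cderiv_cvg].
  - by move=> z /ltW/dV.
  - move=> z /fr fza; rewrite modulusV lef_pV2 ?posrE//; first exact: ltW.
    exact: lt_trans fza.
have fc0 : 0 < modulus (f c) by apply: modulus_gt0; apply: fz; rewrite subrr modulus0 ltW.
by rewrite modulusV lef_pV2 ?posrE// leNgt fc.
Qed.

End Zeros.

(** * Zeros of a continuous family of entire functions *)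

Section EntireFamily.
Variables (R : realType) (X : topologicalType) (f : X -> CC R -> CC R).

Hypothesis f_cont : forall (z : CC R) (x : X) (e : R), 0 < e ->
  \forall t \near x, modulus (f t z - f x z) < e.
Hypothesis f_equi : forall (z : CC R) (e : R), 0 < e ->
  \forall z' \near z, forall x, modulus (f x z' - f x z) < e.
Hypothesis f_entire : forall x z, exists k, cderiv (f x) z k.
Hypothesis f_nonzero : forall x, exists z, f x z != 0.

Lemma family_continuous (x : X) (z : CC R) (e : R) : 0 < e ->
  \forall z' \near z & t \near x, modulus (f t z' - f x z) < e.
Proof.
move=> e0; have e20 : 0 < e / 2 by rewrite divr_gt0.
exists ([set z' | forall t, modulus (f t z' - f t z) < e / 2],
        [set t | modulus (f t z - f x z) < e / 2]).
  by split; [exact: f_equi|exact: f_cont].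
move=> [z' t] [/= h1 h2]; have := h1 t.
by have := modulus_triangle (f t z) (f t z') (f x z); lra.
Qed.

Lemma zero_set_closed (x : X) (z : CC R) : ~ f x z = 0 ->
  \forall z' \near z & t \near x, ~ f t z' = 0.
Proof.
move=> /eqP/modulus_gt0/(family_continuous x z); apply: filterS => -[z' t] /=.
by move=> + t0; rewrite t0 sub0r modulusN ltxx.
Qed.

(** A tube-lemma argument in which [a] tends to [0] from the right while [t] tends to [x], so that
    compactness yields a single [a]. *)
Lemma family_lower_bound (x : X) (K : set (CC R)) : compact K ->
  (forall z, K z -> f x z <> 0) ->
  exists2 a, 0 < a & \forall t \near x, forall z, K z -> a < modulus (f t z).
Proof.
move=> /compact_near_coveringP cover fK.
have near_xa : \forall ta \near filter_prod (nbhs x) (0 : R)^'+,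
    K `<=` (fun z => ta.2 < modulus (f ta.1 z)).
  apply: (cover _ _ (fun (ta : X * R) z => ta.2 < modulus (f ta.1 z))) => z /fK/eqP fz.
  have m0 := modulus_gt0 fz.
  have m20 : 0 < modulus (f x z) / 2 by rewrite divr_gt0.
  have [[A B] [/= zA xB] AB] := family_continuous x z m20.
  exists (A, B `*` [set a | a < modulus (f x z) / 2]).
    split => //; exists (B, [set a | a < modulus (f x z) / 2]) => //=; split => //=.
    exact: nbhs_right_lt.
  move=> [z' [t a]] [/= Az' [Bt al]]; have /= := AB (z', t) (conj Az' Bt).
  by have := modulus_triangle (f t z') (f x z) 0; rewrite !subr0 modulusBC; lra.
have [[A B] [/= xA B0] AB] := near_xa.
have [a [a0 Ba]] : exists a, 0 < a /\ B a.
  have : \forall a \near (0 : R)^'+, 0 < a /\ B a.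
    by apply: filterI => //; exact: nbhs_right_gt.
  by move=> /filter_ex[a ?]; exists a.
exists a => //; apply: filterS xA => t At z Kz.
exact: (AB (t, a)).
Qed.

Lemma family_upper_bound (x : X) (K : set (CC R)) : compact K ->
  exists M, \forall t \near x, forall z, K z -> modulus (f t z) <= M.
Proof.
move=> /compact_near_coveringP cover.
have near_xM : \forall tM \near filter_prod (nbhs x) (+oo : set_system R),
    K `<=` (fun z => modulus (f tM.1 z) <= tM.2).
  apply: (cover _ _ (fun (tM : X * R) z => modulus (f tM.1 z) <= tM.2)) => z _.
  have [[A B] [/= zA xB] AB] := family_continuous x z ltr01.
  exists (A, B `*` [set M | modulus (f x z) + 1 <= M]).
    split => //; exists (B, [set M | modulus (f x z) + 1 <= M]) => //=; split => //=.
    by apply: nbhs_pinfty_ge; exact: num_real.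
  move=> [z' [t M]] [/= Az' [Bt Ml]]; have /= := AB (z', t) (conj Az' Bt).
  by have := modulus_triangle (f x z) (f t z') 0; rewrite !subr0; lra.
have [[A B] [/= xA B0] AB] := near_xM.
have [M BM] := filter_ex B0.
exists M; apply: filterS xA => t At z Kz.
exact: (AB (t, M)).
Qed.

Lemma compact_circle (c : CC R) (r : R) : compact [set z | modulus (z - c) = r].
Proof.
apply: (@subclosed_compact _ _ [set z | modulus (z - c) <= r]).
- apply: (@closed_comp _ _ (fun z : CC R => modulus (z - c)) [set x | x = r]).
    by move=> z _; exact: modulusB_continuous.
  exact: closed_eq.
- exact: compact_disc.
- by move=> z /= ->.
Qed.

(** Near [x], the modulus of [f t] stays above [a] at a point [p] with [f x p != 0] and below [M] on
    a large circle; [zeros_bound] then bounds [3 ^+ size s] uniformly in [t]. *)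
Lemma family_zeros_finite (x : X) (c : CC R) (r : R) : exists N, \forall t \near x, forall s,
  uniq s -> (forall z, z \in s -> f t z = 0 /\ disc c r z) -> (size s <= N)%N.
Proof.
have [p fp] := f_nonzero x; have m0 := modulus_gt0 fp.
have m20 : 0 < modulus (f x p) / 2 by rewrite divr_gt0.
(* Large enough for the disc of radius [rho] about [p] to contain [disc c r]. *)
pose rho := `|r| + modulus (c - p) + 1.
have rho0 : 0 < rho by rewrite ltr_wpDl// addr_ge0// modulus_ge0.
have [M near_M] := family_upper_bound x (@compact_circle p (4 * rho)).
pose a := modulus (f x p) / 2.
exists (Num.bound (`|M| / a)).
apply: filterS2 near_M (f_cont p x m20) => t tM tp s us sz.
have h : modulus (f t p) * 3 ^+ size s <= M.
  apply: (@zeros_bound R (f t) p rho) => // zeta /sz[f0 dz]; split => //.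
  have := modulus_triangle c zeta p; have := ler_norm r.
  by move: dz; rewrite /disc /= /rho; lra.
have ap : a < modulus (f t p).
  by have := modulus_triangle (f t p) (f x p) 0; rewrite !subr0 modulusBC /a; lra.
have aM : a * 3 ^+ size s <= `|M|.
  apply: (@le_trans _ _ M); last exact: ler_norm.
  by apply: le_trans h; rewrite ler_wpM2r ?exprn_ge0// ltW.
rewrite -(ler_nat R); apply/ltW; apply: (@le_lt_trans _ _ (`|M| / a)).
  rewrite ler_pdivlMr// mulrC; apply: le_trans aM; rewrite ler_pM2l//.
  by rewrite -natrX ler_nat ltnW// ltn_expl.
by apply: archi_boundP; rewrite divr_ge0// ltW.
Qed.

(** Zeros on all the circles of radius [e / i.+1] would violate [family_zeros_finite], so one circle
    is free of them. For nearby [t] the modulus stays bounded below on it and is small at [z], so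
    [zero_in_disc] provides a zero inside. *)
Lemma family_isolating (x : X) (z : CC R) (e : R) : f x z = 0 -> 0 < e ->
  exists r, [/\ 0 < r, r <= e &
    \forall t \near x, isolating (fun x z => f x z = 0) [set t] z r].
Proof.
move=> fxz e0.
have [r [r0 re fr]] : exists r, [/\ 0 < r, r <= e &
    forall z', modulus (z' - z) = r -> f x z' <> 0].
  apply: contrapT => nr.
  have /choice[zeta zetaP] : forall i : nat, exists z',
      modulus (z' - z) = e / i.+1%:R /\ f x z' = 0.
    move=> i; apply: contrapT => nz'; apply: nr; exists (e / i.+1%:R); split.
    - by rewrite divr_gt0.
    - by rewrite ler_pdivrMr// ler_peMr// ?ler1n// ltW.
    - by move=> z' zr z0; apply: nz'; exists z'.
  (* The circle for [i = 0] has radius [e], hence the larger open disc. *)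
  have [N /nbhs_singleton NP] := family_zeros_finite x z (e + 1).
  have : (size [seq zeta i | i <- iota 0 N.+1] <= N)%N.
    apply: NP => [|_ /mapP[i _ ->]]; last first.
      have [zi f0] := zetaP i; split => //; rewrite /disc /= zi.
      apply: (@le_lt_trans _ _ e); last by rewrite ltrDl.
      by rewrite ler_pdivrMr// ler_peMr// ?ler1n// ltW.
    rewrite map_inj_in_uniq ?iota_uniq// => i j _ _ ij.
    have := (zetaP i).1; rewrite ij (zetaP j).1 => /(mulfI (lt0r_neq0 e0))/invr_inj/eqP.
    by rewrite eqr_nat eqSS => /eqP ->.
  by rewrite size_map size_iota ltnn.
exists r; split => //.
have [a a0 near_a] := family_lower_bound (@compact_circle z r) fr.
apply: filterS2 near_a (f_cont z x a0) => t ta tz _ ->; split.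
  by move=> z' z0; apply/eqP => /ta; rewrite z0 modulus0 ltNge (ltW a0).
apply: (@zero_in_disc R (f t) z r a) => //.
by move: tz; rewrite fxz subr0.
Qed.

End EntireFamily.

(** * Lifting roots of a Lorch entire function *)

Unset Implicit Arguments.

Theorem theorem2p4 (R : realType) (X : topologicalType)
    (X_compact : compact [set: X]) (X_hausdorff : hausdorff_space X)
    (X_connected : connected [set: X])
    (X_locally_connected : locally_connected X)
    (X_unicoherent : hereditarily_unicoherent X)
    (F : CX X R -> CX X R)
    (F_entire : lorch_entire F)
    (F_nondegenerate : forall x : X, ~ degenerate F x)
    (F_no_asymptotic_roots : no_asymptotic_roots F)
    (x0 : X) (z0 : CC R) (F_x0_z0 : assoc_map F x0 z0 = 0) :
  exists w : CX X R,
    w x0 = z0 /\ forall x : X, assoc_map F x (w x) = 0.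
Proof.
(* Testing the Lorch differential at constants against constants gives complex differentiability in
   [z], with an error uniform in [x]. *)
have F_expand (z : CC R) : exists2 g : CX X R, continuous g &
    forall e : R, 0 < e -> \forall z' \near z, forall x,
      modulus (assoc_map F x z' - assoc_map F x z - g x * (z' - z)) <= e * modulus (z' - z).
  have [g gF] := F_entire (cst z); exists g; first exact: cts_fun.
  move=> e e0; have [d d0 Fd] := gF e e0.
  have supE (z' : CC R) : supnorm ((cst z' : X -> CC R) \- (cst z : X -> CC R)) = modulus (z' - z).
    rewrite /supnorm (_ : [set _ | _ in _] = [set modulus (z' - z)]) ?sup1//.
    by apply/seteqP; split => [_ [x _ <-]//|_ ->]; exists x0.
  apply/nbhs_modulusP; exists d => // z' zd x.
  have := Fd (cst z'); rewrite supE => /(_ zd); apply: le_trans.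
  apply: (@le_supnorm R X ((F (cst z') \- F (cst z)) \- (g \* (cst z' \- cst z))) x X_compact).
  move=> y; apply: cvgB; first by apply: cvgB; exact: cts_fun.
  by apply: cvgMr_tmp; exact: cts_fun.
pose Z x z := assoc_map F x z = 0.
have F_cont (z : CC R) (x : X) (e : R) : 0 < e ->
    \forall t \near x, modulus (assoc_map F t z - assoc_map F x z) < e.
  by move=> e0; have /cvg_modulusP/(_ e e0) := @cts_fun _ _ (F (cst z)) x.
have F_equi (z : CC R) (e : R) : 0 < e ->
    \forall z' \near z, forall x, modulus (assoc_map F x z' - assoc_map F x z) < e.
  move=> e0; have [g cg /(_ 1 ltr01) Fz] := F_expand z.
  (* A Lipschitz constant at [z]: the multiplier contributes [supnorm g], the error term [1]. *)
  pose M := supnorm g + 1.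
  have gM x : modulus (g x) <= supnorm g by exact: le_supnorm.
  have M0 : 0 < M by rewrite ltr_wpDl//; exact: le_trans (modulus_ge0 _) (gM x0).
  have near_z : \forall z' \near z, modulus (z' - z) < e / M.
    by apply/nbhs_modulusP; exists (e / M) => //; rewrite divr_gt0.
  apply: filterS2 Fz near_z => z' Fz'; rewrite ltr_pdivlMr// => zM x.
  apply: le_lt_trans zM; rewrite mulrDr mulr1.
  rewrite -[assoc_map F x z' - _](subrK (g x * (z' - z))).
  apply: le_trans (modulusD _ _) _; rewrite addrC; apply: lerD; last first.
    by rewrite -[leRHS]mul1r.
  by rewrite modulusM mulrC ler_wpM2l// modulus_ge0.
have F_holo x z : exists k, cderiv (assoc_map F x) z k.
  have [g _ Fz] := F_expand z; exists (g x); apply/cderivP => e e0.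
  by apply: filterS (Fz e e0).
have F_nonzero x : exists z, assoc_map F x z != 0.
  apply: contrapT => nz; apply: (F_nondegenerate x); exists 0 => z.
  by apply/eqP; apply: contrapT => /negP z1; apply: nz; exists z.
have [|w [[cw wZ] wx0]] := @global_lift R X X_compact X_hausdorff X_connected
    X_locally_connected X_unicoherent Z (zero_set_closed F_cont F_equi)
    (family_isolating F_cont F_equi F_holo F_nonzero)
    (family_zeros_finite F_cont F_equi F_holo F_nonzero) _ x0 z0 F_x0_z0.
  (* If no bound works, then for every [A] the modulus of [w] exceeds [A] on [Y] near [x], so [w] is
     an asymptotic root. *)
  move=> Y w x cY [cw wZ] clx nYx; apply: contrapT => nM.
  apply: F_no_asymptotic_roots; exists Y, x, w; split => //.
  - apply/subspace_continuousP => y Yy; apply/cvg_modulusP => e e0.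
    by rewrite near_withinE; exact: (cw y Yy e e0).
  - by move=> y /wZ[].
  - apply/cvgryPgt => A; rewrite near_withinE; apply: contrapT => nA; apply: nM.
    exists A => V xV; apply: contrapT => nV; apply: nA.
    apply: filterS xV => t Vt Yt; rewrite ltNge; apply/negP => tA.
    by apply: nV; exists t.
have w_cont : continuous w.
  by move=> x; apply/cvg_modulusP => e e0; apply: filterS (cw x I e e0) => t; apply.
by exists (mkcts w_cont); split => // x; have [] := wZ x I.
Qed.
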